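(* Let $v$ be a finite place of a number field or function field $k$, and $X/k$ a curve of genus $g>1$ with semistable reduction at $v$. Assume that the reduction graph $R(X_v)$ is elementary, i.e. every edge is contained in at most one cycle. Then $$\varphi(X_v)\ge \frac{g-1}{6g}\,\delta_0(X_v)+\sum_{0<i\le g/2}\frac{2i(g-i)}{g}\,\delta_i(X_v),$$ and equality holds if and only if every circle $C$ of $R(X_v)$ contains at most one point $A$ with $g_A>0$.
   Context: $R(X_v)$: metrized graph with vertices the irreducible components of the special fibre of the minimal regular semistable model of $X$ at $v$ (over an algebraic closure of the residue field) and one edge of length $1$ for each singular point. Genus function $q(x)$: geometric genus of the component for a vertex $x$, $0$ otherwise; valence $v(x)$; $K=\sum_x(v(x)-2+2q(x))x$; $g=\sum q(x)+b_1(R(X_v))$. Admissible measure $\mu=\frac1g(\sum_x q(x)\delta_x+\sum_e dx_e/(\ell_e+r_e))$, $r_e$ the effective resistance between the endpoints of edge $e$ in the graph with $e$ removed ($\infty$ if disconnected, $0$ for a loop). $r(x,y)$ the effective resistance. $G(x,x)=\int r(x,y)d\mu(y)-\frac12\iint r\,d\mu d\mu$ (diagonal of the admissible Green function). $\delta(X_v)$ = total length = number of singular points. $\varphi(X_v)=-\frac14\delta(X_v)+\frac14\int_{R(X_v)}G(x,x)((10g+2)d\mu-\delta_K)$. $\delta_0(X_v)$ (resp. $\delta_i(X_v)$, $0<i\le g/2$) is the number of singular points $x$ of the special fibre such that the local normalization at $x$ is connected (resp. is a disjoint union of two curves of genus $i$ and $g-i$). For a circle $C\subset R(X_v)$ and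 $A\in C$, $\Gamma_A$ denotes the closure of the connected component of $A$ in $R(X_v)\setminus(C\setminus\{A\})$ and $g_A=\sum_{x\in\Gamma_A}q(x)+b_1(\Gamma_A)$. *)

(* Defs.v *)
From HB Require Import structures.
From mathcomp Require Import all_boot all_order all_algebra.
From mathcomp Require Import all_classical all_reals all_analysis.

Set Implicit Arguments.
Unset Strict Implicit.
Unset Printing Implicit Defensive.

Import Order.TTheory GRing.Theory Num.Theory.
(** Finite multigraphs; loops and parallel edges are allowed.  The orientation
    of an edge by [src] and [tgt] is an arbitrary choice. *)

Record multigraph := Multigraph {
  vertex : finType;
  edge : finType;
  src : edge -> vertex;
  tgt : edge -> vertex }.

Section Multigraph.
Variable G : multigraph.
Implicit Types (F C : {set edge G}) (W : {set vertex G}).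

Definition joins (e : edge G) (x y : vertex G) : bool :=
  ((src e == x) && (tgt e == y)) || ((src e == y) && (tgt e == x)).

Definition adj F : rel (vertex G) := fun x y => [exists e in F, joins e x y].

Definition connected_graph : Prop :=
  forall x y : vertex G, connect (adj [set: edge G]) x y.

(** A loop counts twice. *)
Definition valence (x : vertex G) : nat :=
  #|[set e : edge G | src e == x]| + #|[set e : edge G | tgt e == x]|.

(** First Betti number of the subgraph with vertex set [W] and edge set [F];
    the edges in [F] are assumed to have both end points in [W]. *)
Definition betti1 W F : nat := #|F| + n_comp (adj F) W - #|W|.

(** An oriented edge is [(e, b)], with [b] true for the direction from [src e]
    to [tgt e]. *)
Definition dtail (d : edge G * bool) : vertex G := if d.2 then src d.1 else tgt d.1.
Definition dhead (d : edge G * bool) : vertex G := if d.2 then tgt d.1 else src d.1.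

(** [C] is the edge set of a circle: a nonempty closed walk without repeated
    vertex or edge (length one for a loop, two for a pair of parallel edges). *)
Definition circle C : Prop :=
  exists s : seq (edge G * bool),
    [/\ s != [::],
        cycle (fun d d' => dhead d == dtail d') s,
        uniq [seq dtail d | d <- s],
        uniq [seq d.1 | d <- s] &
        C = [set e in [seq d.1 | d <- s]]].

Definition elementary : Prop :=
  forall (e : edge G) C C', circle C -> circle C' -> e \in C -> e \in C' -> C = C'.

Definition ends F : {set vertex G} := @src G @: F :|: @tgt G @: F.

(** For a vertex [A] on a circle [C]: [branch_core C A] is the set of vertices
    in the connected component of [A] in the complement of [C \ {A}]; this
    component contains exactly the open edges in [branch_edges C A], and
    [branch_vertices C A] is the set of vertices in its closure. *)
Definition branch_core C (A : vertex G) : {set vertex G} :=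
  [set x | connect (fun y z => [&& (y == A) || (y \notin ends C),
                                   (z == A) || (z \notin ends C) &
                                   adj (~: C) y z]) A x].

Definition branch_edges C (A : vertex G) : {set edge G} :=
  [set e | (e \notin C) &&
           ((src e \in branch_core C A) || (tgt e \in branch_core C A))].

Definition branch_vertices C (A : vertex G) : {set vertex G} :=
  branch_core C A :|: ends (branch_edges C A).

End Multigraph.

(** Dual graph of the special fibre over an algebraic closure of the residue
    field: vertices are the irreducible components, edges the singular points,
    the ends of an edge the components carrying its two branches, and
    [ggenus x] is the geometric genus of the component [x]. *)

Record special_fibre := SpecialFibre {
  dual_graph :> multigraph;
  ggenus : vertex dual_graph -> nat }.

Section SpecialFibre.
Variable X : special_fibre.
Implicit Types (F C : {set edge X}) (W : {set vertex X}).

Definition subgraph_genus W F : nat := \sum_(x in W) ggenus x + betti1 W F.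

Definition genus : nat := subgraph_genus [set: vertex X] [set: edge X].

(** Special fibre of the minimal regular model: it is connected and has no
    exceptional component, that is, no smooth rational component meeting the
    rest of the fibre in a single point. *)
Definition minimal_semistable : Prop :=
  connected_graph X /\
  (forall x : vertex X, ggenus x = 0 -> 2 <= valence x).

(** Normalizing the fibre at the singular point [e] removes the edge [e]. *)
Definition nonseparating (e : edge X) : bool :=
  connect (adj (~: [set e])) (src e) (tgt e).

(** Arithmetic genus of the component through [x] of the fibre normalized at
    [e]. *)
Definition side_genus (e : edge X) (x : vertex X) : nat :=
  let W := [set y | connect (adj (~: [set e])) x y] in
  subgraph_genus W [set f | (f != e) && (src f \in W)].

Definition separating_of_type (e : edge X) (i j : nat) : bool :=
  ~~ nonseparating e &&
  (((side_genus e (src e) == i) && (side_genus e (tgt e) == j)) ||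
   ((side_genus e (src e) == j) && (side_genus e (tgt e) == i))).

Definition delta0 : nat := #|[set e : edge X | nonseparating e]|.

Definition delta (i : nat) : nat :=
  #|[set e : edge X | separating_of_type e i (genus - i)]|.

End SpecialFibre.

Local Open Scope ring_scope.

(** Metrized graphs.  A point is either a vertex or a pair [(e, t)], the point
    of the edge [e] at distance [t] from [src e].  The pairs with
    [0 < t < len e] represent the points that are not vertices; no meaning is
    attached to [t < 0] or [len e < t]. *)

Record mgraph (R : realType) := MGraph {
  mg_graph :> multigraph;
  len : edge mg_graph -> R }.

Definition gpoint (R : realType) (G : mgraph R) : Type :=
  (vertex G + edge G * R)%type.

Section Resistance.
Variables (R : realType) (G : mgraph R).

(** Potential [u] and current [c] (counted positively from [src] to [tgt]) in
    the network with edge set [F], resistances [len], when a unit current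
    enters at [x] and leaves at [y]: Ohm's law and Kirchhoff's current law. *)
Definition unit_current (F : {set edge G}) (x y : vertex G)
    (u : vertex G -> R) (c : edge G -> R) : Prop :=
  (forall e, e \in F -> u (src e) - u (tgt e) = len e * c e) /\
  (forall z, \sum_(e in F | src e == z) c e - \sum_(e in F | tgt e == z) c e =
             (z == x)%:R - (z == y)%:R).

(** Effective resistance between vertices of the network with edge set [F];
    junk value 0 if [x] and [y] are not connected in [F]. *)
Definition vresistance (F : {set edge G}) (x y : vertex G) : R :=
  xget 0 (fun r => exists u c, unit_current F x y u c /\ r = u x - u y).

End Resistance.

Section Subdivision.
Variables (R : realType) (G : mgraph R).

(** [G] with a new vertex [None] on [e0] at distance [s] from [src e0]; the
    edge [e0] is replaced by [Some e0] from [src e0] to [None], followed by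
    [None] from [None] to [tgt e0]. *)
Definition subdivide (e0 : edge G) (s : R) : mgraph R :=
  @MGraph R
    (@Multigraph (option (vertex G)) (option (edge G))
       (fun e => if e is Some e1 then Some (src e1) else None)
       (fun e => if e is Some e1
                 then if e1 == e0 then None else Some (tgt e1)
                 else Some (tgt e0)))
    (fun e => if e is Some e1
              then if e1 == e0 then s else len e1
              else len e0 - s).

Definition refine_at (p : gpoint G) : mgraph R :=
  match p with inl _ => G | inr (e, s) => subdivide e s end.

Definition marked (p : gpoint G) : vertex (refine_at p) :=
  match p return vertex (refine_at p) with
  | inl x => x
  | inr (e, s) => None
  end.

Definition old_vertex (p : gpoint G) : vertex G -> vertex (refine_at p) :=
  match p return vertex G -> vertex (refine_at p) with
  | inl _ => fun x => x
  | inr (e, s) => fun x => Some x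
  end.

(** The point of the refinement lying at the same place as [p']. *)
Definition relocate (p : gpoint G) : gpoint G -> gpoint (refine_at p) :=
  match p return gpoint G -> gpoint (refine_at p) with
  | inl _ => fun p' => p'
  | inr (e, s) => fun p' : gpoint G =>
      match p' return gpoint (subdivide e s) with
      | inl x => inl (Some x)
      | inr (e', t) =>
          if e' == e then
            if t < s then inr (Some e', t)
            else if t == s then inl None
            else inr (None, t - s)
          else inr (Some e', t)
      end
  end.

End Subdivision.

(** Effective resistance between two points: make both of them vertices. *)
Definition resistance (R : realType) (G : mgraph R) (p p' : gpoint G) : R :=
  vresistance [set: edge (refine_at (relocate p p'))]
    (old_vertex (relocate p p') (marked p)) (marked (relocate p p')).

Section Admissible.
Variables (R : realType) (X : special_fibre).

Definition reduction_graph : mgraph R := @MGraph R X (fun _ => 1).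

Local Notation RX := reduction_graph.
Local Notation g := (genus X).

(** [1 / (l_e + r_e)], which is 0 for [r_e] infinite. *)
Definition edge_density (e : edge RX) : R :=
  if connect (adj (~: [set e])) (src e) (tgt e)
  then (len e + vresistance (~: [set e]) (src e) (tgt e))^-1
  else 0.

(** Integral of [f] against the admissible measure. *)
Definition mu_integral (f : gpoint RX -> R) : R :=
  g%:R^-1 *
  (\sum_(x : vertex RX) (ggenus (x : vertex X))%:R * f (inl x) +
   \sum_(e : edge RX) edge_density e *
     (\int[lebesgue_measure]_(t in `[0, len e]) f (inr (e, t)))).

(** Integral of [f] against the Dirac measure of the canonical divisor. *)
Definition K_integral (f : gpoint RX -> R) : R :=
  \sum_(x : vertex RX)
    ((valence x)%:R - 2 + 2 * (ggenus (x : vertex X))%:R) * f (inl x).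

(** Diagonal of the admissible Green function. *)
Definition green_diag (p : gpoint RX) : R :=
  mu_integral (fun p' => resistance p p') -
  2^-1 * mu_integral (fun p1 => mu_integral (fun p2 => resistance p1 p2)).

Definition total_length : R := \sum_(e : edge RX) len e.

Definition phi : R :=
  - (4^-1 * total_length) +
  4^-1 * ((10 * g%:R + 2) * mu_integral green_diag - K_integral green_diag).

Definition on_circle (C : {set edge X}) (A : gpoint RX) : Prop :=
  match A with
  | inl x => x \in ends C
  | inr (e, t) => e \in C /\ 0 < t < len e
  end.

(** For a point [A] of [C] that is not a vertex, the component of [A] in the
    complement of [C \ {A}] is [{A}], whose genus is 0. *)
Definition branch_genus (C : {set edge X}) (A : gpoint RX) : nat :=
  match A with
  | inl x => subgraph_genus (X := X) (branch_vertices C x) (branch_edges C x)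
  | inr _ => 0%N
  end.

End Admissible.

(* Main.v *)
Require Import Defs.
From mathcomp Require Import all_boot all_order all_algebra.
From mathcomp Require Import ring lra zify.
From mathcomp Require Import all_classical all_reals all_analysis measurable_realfun.
Import Order.TTheory GRing.Theory Num.Theory.
Import numFieldNormedType.Exports.
Local Open Scope ring_scope.

Set Implicit Arguments.
Unset Strict Implicit.
Unset Printing Implicit Defensive.

(** An elementary graph is a tree of blocks, each a separating edge or a circle,
    and the effective resistance [r] is the sum over the blocks of the resistances
    between the retractions of the two points.  This is proved by checking that
    the Laplacian of [r (-, y)] plus twice the Dirac measure at [y] does not change
    when [y] crosses an edge, since only the block of that edge matters.

    Integrating [r], which is quadratic along edges, against the admissible measure
    expresses [phi] through three sums, each additive over the blocks:
      [phi = - E / 4 + (1/g) \sum_(x, y) M_x M_y r (x, y)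
             + (1/4g) \sum_(x, y) K_x M_y r (x, y) + (5g - 2) / (12g) \sum_e k_e ^ 2],
    where [k_e = 1 - r (src e, tgt e)] is the density of [mu] on [e] up to the factor
    [g], [M] is [g mu] pushed to the vertices, and [K] is the Laplacian of [r (-, y)]
    away from [y].  Fluxes of [r (-, y)] give the masses of [M] and [K] cut off by a
    block.  A separating edge with sides of genus [i] and [g - i] then contributes
    [2i(g-i)/g], and a circle of length [l] contributes [l(g-1)/(6g)] plus
    [(1/g) \sum_(A, B) g_A g_B r (A, B)]; the last sum is the defect in the
    inequality. *)

Lemma big_option (R : nmodType) (T : finType) (F : option T -> R) :
  \sum_(x : option T) F x = F None + \sum_(x : T) F (Some x).
Proof.
rewrite (bigD1 None) //= (reindex_omap Some id) /=; last by case.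
by congr (_ + _); apply: eq_bigl => x; rewrite eqxx.
Qed.

Lemma sum_delta (R : pzRingType) (T : finType) (u : T -> R) (x : T) :
  \sum_z u z * (z == x)%:R = u x.
Proof.
rewrite (bigD1 x) //= eqxx mulr1 big1 ?addr0 // => z zx.
by rewrite (negbTE zx) mulr0.
Qed.

(** * Effective resistance from its Laplacian *)

Section Certificate.
Variables (R : realType) (G : mgraph R).
Implicit Types (r : vertex G -> vertex G -> R) (K : vertex G -> R).

(* The coboundary of the indicator of [z]; it turns the two sums of Kirchhoff's
   law into a single one. *)
Definition bdry (z : vertex G) (e : edge G) : R :=
  (src e == z)%:R - (tgt e == z)%:R.

(* The Laplacian of [r (-, y)] is [K - 2 delta_y] with [K] independent of
   [y]; together with symmetry this characterizes the effective resistance. *)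
Definition resistance_cert r K : Prop :=
  [/\ forall z, r z z = 0,
      forall y z, r y z = r z y,
      forall e : edge G, len e != 0 &
      forall z y, \sum_e bdry z e * ((r (src e) y - r (tgt e) y) / len e) =
                  K z - 2 * (z == y)%:R].

Lemma sum_bdry (F : {set edge G}) (c : edge G -> R) z :
  \sum_(e in F | src e == z) c e - \sum_(e in F | tgt e == z) c e =
  \sum_(e in F) bdry z e * c e.
Proof.
rewrite big_mkcondr /= [X in _ - X]big_mkcondr /= -sumrB; apply: eq_bigr => e _.
by rewrite /bdry; case: eqP; case: eqP => _ _ /=; ring.
Qed.

Lemma sum_vertex_bdry (u : vertex G -> R) e :
  \sum_z u z * bdry z e = u (src e) - u (tgt e).
Proof.
rewrite -(sum_delta u (src e)) -(sum_delta u (tgt e)) -sumrB.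
by apply: eq_bigr => z _; rewrite /bdry mulrBr !(eq_sym z).
Qed.

(* Reciprocity: both potential differences equal [\sum_e len e * c e * c' e]. *)
Lemma unit_current_unique (F : {set edge G}) x y u c u' c' :
  unit_current F x y u c -> unit_current F x y u' c' -> u x - u y = u' x - u' y.
Proof.
have pw (v1 : vertex G -> R) (c1 : edge G -> R) v2 c2 :
    unit_current F x y v1 c1 -> unit_current F x y v2 c2 ->
    v1 x - v1 y = \sum_(e in F) len e * c1 e * c2 e.
  move=> [ohm1 kir1] [ohm2 kir2].
  rewrite -(sum_delta v1 x) -(sum_delta v1 y) -sumrB.
  under eq_bigr => z _ do rewrite -mulrBr -kir2 sum_bdry mulr_sumr.
  rewrite exchange_big /=; apply: eq_bigr => e eF.
  under eq_bigr => z _ do rewrite mulrA.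
  by rewrite -mulr_suml sum_vertex_bdry ohm1.
move=> hu hv; rewrite (pw _ _ _ _ hu hv) (pw _ _ _ _ hv hu).
by apply: eq_bigr => e _; ring.
Qed.

Lemma vresistanceE (F : {set edge G}) x y u c :
  unit_current F x y u c -> vresistance F x y = u x - u y.
Proof.
move=> h; rewrite /vresistance; case: xgetP => [r _ [u' [c' [h' ->]]]|/(_ (u x - u y))].
  exact: unit_current_unique h' h.
by case; exists u, c.
Qed.

(** Superposition: the common part [K] cancels in the difference of the two Laplacians, and half of
    what remains is [delta_x - delta_y], the source of a unit current from [x] to [y]. *)
Definition cert_potential r x y z : R := (r z y - r z x) / 2.
Definition cert_current r x y e : R :=
  (cert_potential r x y (src e) - cert_potential r x y (tgt e)) / len e.

Lemma cert_unit_current r K x y : resistance_cert r K ->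
  unit_current [set: edge G] x y (cert_potential r x y) (cert_current r x y).
Proof.
case=> r0 rC l0 rK; split=> [e _|z].
  by rewrite /cert_current mulrC divfK.
rewrite sum_bdry.
have -> : \sum_(e in [set: edge G]) bdry z e * cert_current r x y e =
   (\sum_e bdry z e * ((r (src e) y - r (tgt e) y) / len e)
    - \sum_e bdry z e * ((r (src e) x - r (tgt e) x) / len e)) / 2.
  rewrite -sumrB mulr_suml; apply: eq_big => [e|e _]; first by rewrite inE.
  rewrite /cert_current /cert_potential; by field; rewrite l0.
by rewrite !rK; field.
Qed.

Lemma cert_vresistance r K x y : resistance_cert r K ->
  vresistance [set: edge G] x y = r x y.
Proof.
move=> h; rewrite (vresistanceE (cert_unit_current x y h)).
by case: h => r0 rC _ _; rewrite /cert_potential !r0 (rC y x); field.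
Qed.

End Certificate.

(** * Inserting a new vertex on an edge *)

Section Subdivision.
Variables (R : realType) (G : mgraph R).
Variables (r : vertex G -> vertex G -> R) (K : vertex G -> R).
Variables (e0 : edge G) (s : R).

(** As a function of [s] this is a parabola along [e0] with the values of [r] at both ends; its
    curvature is chosen so that the Laplacian at the new vertex is the same for all old [y]. *)
Definition sub_profile (y : vertex G) : R :=
  (1 - s / len e0) * r (src e0) y + s / len e0 * r (tgt e0) y +
  s / len e0 * (1 - s / len e0) * (len e0 - r (src e0) (tgt e0)).

Definition sub_resistance (y z : vertex (subdivide e0 s)) : R :=
  match y, z with
  | Some y', Some z' => r y' z'
  | Some y', None => sub_profile y'
  | None, Some z' => sub_profile z'
  | None, None => 0
  end.

(** The mass of the new vertex is taken from the ends of [e0] in the proportion [1 - s / len e0] to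
    [s / len e0], so the total stays the same. *)
Definition sub_mass (z : vertex (subdivide e0 s)) : R :=
  if z is Some z' then
    K z' - ((src e0 == z')%:R * (1 - s / len e0) + (tgt e0 == z')%:R * (s / len e0)) *
           ((len e0 - r (src e0) (tgt e0)) / len e0)
  else (len e0 - r (src e0) (tgt e0)) / len e0.

Lemma cert_subdivide : resistance_cert r K -> 0 < s < len e0 ->
  resistance_cert sub_resistance sub_mass.
Proof.
case=> r0 rC l0 rK /andP[s_gt0 s_lt].
have s0 : s != 0 by rewrite gt_eqF.
have ls0 : len e0 - s != 0 by rewrite subr_eq0 gt_eqF.
split.
- by case.
- by case=> [y|] [z|] //=; exact: rC.
- by case=> [e|] //=; case: ifP.
move=> z y; rewrite big_option /=.
(* [T0] is the contribution of an edge of the undivided network; only its term at [e0] has to be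
   replaced by those of the two halves. *)
pose T0 (e : edge G) : R := ((Some (src e) == z)%:R - (Some (tgt e) == z)%:R) *
  ((sub_resistance (Some (src e)) y - sub_resistance (Some (tgt e)) y) / len e).
have -> : forall t : R,
  t + \sum_(e : edge G) @bdry R (subdivide e0 s) z (Some e) *
    ((sub_resistance (Some (src e)) y -
      sub_resistance (if e == e0 then None else Some (tgt e)) y) /
     (if e == e0 then s else len e)) =
  t + ((Some (src e0) == z)%:R - (None == z)%:R) *
      ((sub_resistance (Some (src e0)) y - sub_resistance None y) / s)
    - T0 e0 + \sum_e T0 e.
  move=> t; rewrite (bigD1 e0) //= [\sum_e T0 e](bigD1 e0) //= eqxx.
  rewrite (eq_bigr T0); last by move=> e ne; rewrite /T0 /bdry /= (negbTE ne).
  by rewrite /bdry /= eqxx; ring.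
have sT0 : \sum_e T0 e = if z is Some z' then
    (if y is Some y' then K z' - 2 * (z' == y')%:R
     else K z' - 2 * ((1 - s / len e0) * (z' == src e0)%:R + s / len e0 * (z' == tgt e0)%:R))
    else 0.
  rewrite /T0; clear T0; case: z => [z|]; last by rewrite big1 // => e _; rewrite /= subrr mul0r.
  case: y => [y|] /=; first by rewrite -rK.
  (* With the pole at the new vertex, the potential is an affine combination of the potentials with
     poles at the ends of [e0], up to a constant that differences do not see. *)
  pose q x e := bdry z e * ((r (src e) x - r (tgt e) x) / len e).
  rewrite (eq_bigr (fun e => (1 - s / len e0) * q (src e0) e + s / len e0 * q (tgt e0) e)).
    by rewrite big_split /= -!mulr_sumr !rK; ring.
  move=> e _; rewrite /q /sub_profile /bdry /= !(inj_eq Some_inj).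
  by rewrite !(rC _ (src e0)) !(rC _ (tgt e0)); ring.
rewrite {}sT0 /T0 /bdry /=; clear T0; case: z => [z|] /=; case: y => [y|] /=;
  rewrite ?eqxx ?(inj_eq Some_inj) ?(eq_sym z) /sub_profile ?r0 ?(rC (tgt e0) (src e0)) /=; field;
  by rewrite ?ls0 ?s0 ?l0.
Qed.

End Subdivision.

(** * Resistances between arbitrary points of a graph with unit edges *)

Section UnitLengths.
Variables (R : realType) (G : mgraph R).
Variables (r : vertex G -> vertex G -> R) (K : vertex G -> R).
Hypothesis len1 : forall e : edge G, len e = 1.
Hypothesis rP : resistance_cert r K.

Definition edge_gap (e : edge G) : R := 1 - r (src e) (tgt e).

Definition edge_profile (e : edge G) (t : R) (y : vertex G) : R :=
  (1 - t) * r (src e) y + t * r (tgt e) y + t * (1 - t) * edge_gap e.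

Lemma sub_profile1 e t y : sub_profile r e t y = edge_profile e t y.
Proof. by rewrite /sub_profile /edge_profile /edge_gap len1 !divr1. Qed.

Lemma resistance_vv x y : resistance (inl x : gpoint G) (inl y) = r x y.
Proof. exact: cert_vresistance rP. Qed.

Lemma resistance_ve x e t : 0 < t < 1 ->
  resistance (inl x : gpoint G) (inr (e, t)) = edge_profile e t x.
Proof.
move=> t01; have t01' : 0 < t < len e by rewrite len1.
by rewrite /resistance (cert_vresistance _ _ (cert_subdivide rP t01')) /= sub_profile1.
Qed.

Lemma resistance_ev x e t : 0 < t < 1 ->
  resistance (inr (e, t) : gpoint G) (inl x) = edge_profile e t x.
Proof.
move=> t01; have t01' : 0 < t < len e by rewrite len1.
by rewrite /resistance (cert_vresistance _ _ (cert_subdivide rP t01')) /= sub_profile1.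
Qed.

(** Subdividing returns a certificate, so the construction can be repeated for the second point. *)
Lemma resistance_ee e f s t : e != f -> 0 < s < 1 -> 0 < t < 1 ->
  resistance (inr (e, s) : gpoint G) (inr (f, t)) =
  (1 - t) * edge_profile e s (src f) + t * edge_profile e s (tgt f) + t * (1 - t) * edge_gap f.
Proof.
move=> ef s01 t01; have s01' : 0 < s < len e by rewrite len1.
have h := cert_subdivide rP s01'.
rewrite /resistance /= eq_sym (negbTE ef).
have t01' : 0 < t < @len _ (subdivide e s) (Some f) by rewrite /= eq_sym (negbTE ef) len1.
rewrite (cert_vresistance _ _ (cert_subdivide h t01')) /= /sub_profile /=.
by rewrite !(eq_sym f) !(negbTE ef) !len1 /= !divr1 !sub_profile1.
Qed.

Lemma resistance_same e s t : 0 < s < 1 -> 0 < t < 1 ->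
  resistance (inr (e, s) : gpoint G) (inr (e, t)) =
  `|s - t| - edge_gap e * (s - t) ^+ 2.
Proof.
move=> s01 t01; have s01' : 0 < s < len e by rewrite len1.
have h := cert_subdivide rP s01'.
have [r0 rC _ _] := rP.
have s0 : s != 0 by case/andP: s01 => s0 _; rewrite gt_eqF.
have s1 : 1 - s != 0 by case/andP: s01 => _ s1; rewrite subr_eq0 gt_eqF.
(* The second point falls on the half [Some e] of length [s], on the half [None] of length [1 - s],
   or on the new vertex itself. *)
rewrite /resistance /= eqxx; case: ltgtP => [ts|st|ts].
- have t01' : 0 < t < @len _ (subdivide e s) (Some e).
    by rewrite /= eqxx ts andbT; case/andP: t01.
  rewrite (cert_vresistance _ _ (cert_subdivide h t01')) /= /sub_profile /= !eqxx /=.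
  rewrite !sub_profile1 /edge_profile /edge_gap r0 (rC (tgt e)).
  by rewrite gtr0_norm ?subr_gt0 //; field.
- have t01' : 0 < t - s < @len _ (subdivide e s) None.
    by rewrite /= len1 ltrBrDl addr0 st /= ltrD2r; case/andP: t01.
  rewrite (cert_vresistance _ _ (cert_subdivide h t01')) /= /sub_profile /=.
  rewrite !sub_profile1 /edge_profile /edge_gap r0 len1.
  by rewrite ltr0_norm ?subr_lt0 //; field.
by rewrite (cert_vresistance _ _ h) /= ts subrr normr0; ring.
Qed.

(** Of a unit current between its ends, [e] itself carries [r (src e) (tgt e)]. Deleting [e] leaves
    a flow of strength [1 - r (src e) (tgt e)] with the same potential, which is then rescaled. *)
Lemma vresistance_delete e : r (src e) (tgt e) != 1 ->
  vresistance (~: [set e]) (src e) (tgt e) =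
  r (src e) (tgt e) / (1 - r (src e) (tgt e)).
Proof.
set a := src e; set b := tgt e => rab.
have nz : 1 - r a b != 0 by rewrite subr_eq0 eq_sym.
have [ohm kir] := cert_unit_current a b rP.
have [r0 rC _ _] := rP.
set u := cert_potential r a b in ohm kir; set c := cert_current r a b in ohm kir.
have uab : u a - u b = r a b by rewrite /u /cert_potential !r0 (rC b); field.
have ce : c e = r a b by have := ohm e (finset.in_setT e); rewrite len1 mul1r uab.
rewrite (@vresistanceE _ _ _ _ _ (fun z => u z / (1 - r a b)) (fun f => c f / (1 - r a b))).
  by rewrite -mulrBl uab.
split=> [f _|z]; first by rewrite -mulrBl ohm ?inE // mulrA.
have := kir z; rewrite !sum_bdry (bigD1 e) ?inE //= => kz.
under eq_bigr => f _ do rewrite mulrA.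
rewrite -mulr_suml (eq_bigl (fun f => (f \in [set: edge G]) && (f != e))); last first.
  by move=> f; rewrite !inE.
apply: (mulIf nz); rewrite divfK //; apply/eqP; rewrite -subr_eq0; apply/eqP.
rewrite (_ : \sum_(i in _ | _) _ = (z == a)%:R - (z == b)%:R - bdry z e * c e); last first.
  by rewrite -kz; ring.
by rewrite ce /bdry -/a -/b !(eq_sym _ z); ring.
Qed.

End UnitLengths.

(** * Integrals over edges *)

Section Integrals.
Variable R : realType.
Implicit Types (f h : R -> R) (a b s k : R).

(** The resistance formulas hold at interior points of an edge only, and the end points are null
    sets; continuity of [h] supplies measurability. *)
Lemma eq_Rintegral_open f h a b : continuous h ->
  (forall t, a < t < b -> f t = h t) ->
  \int[lebesgue_measure]_(t in `[a, b]) f t = \int[lebesgue_measure]_(t in `[a, b]) h t.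
Proof.
move=> ch fh.
have mh : measurable_fun `]a, b[%classic h.
  by apply: measurable_funTS; exact: continuous_measurable_fun.
have mf : measurable_fun `]a, b[%classic f.
  apply: eq_measurable_fun mh => t; rewrite inE /= in_itv /= => tab.
  by rewrite fh.
have closed_open (u : R -> R) : measurable_fun `]a, b[%classic u ->
    (\int[lebesgue_measure]_(t in `[a, b]) (u t)%:E)%E =
    (\int[lebesgue_measure]_(t in `]a, b[) (u t)%:E)%E.
  move=> mu; rewrite -integral_itv_obnd_cbnd; last first.
    by apply/measurable_EFinP/measurable_fun_itv_bndo_bndcP.
  by rewrite -integral_itv_bndo_bndc //; exact/measurable_EFinP.
rewrite /Rintegral (closed_open _ mf) (closed_open _ mh); congr fine.
by apply: eq_integral => t; rewrite inE /= in_itv /= => tab; rewrite fh.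
Qed.

Definition quad (c0 c1 c2 t : R) : R := c0 + c1 * t + c2 * t ^+ 2.
Definition iquad (c0 c1 c2 t : R) : R := c0 * t + c1 * t ^+ 2 / 2 + c2 * t ^+ 3 / 3.

Lemma continuous_quad c0 c1 c2 : continuous (quad c0 c1 c2).
Proof.
have -> : quad c0 c1 c2 = horner (c0%:P + c1 *: 'X + c2 *: 'X^2).
  by apply/funext => t; rewrite /quad !(hornerD, hornerZ, hornerX, hornerXn, hornerC).
exact: continuous_horner.
Qed.

Lemma Rintegral_quad a b f c0 c1 c2 : a < b ->
  (forall t, a < t < b -> f t = quad c0 c1 c2 t) ->
  \int[lebesgue_measure]_(t in `[a, b]) f t = iquad c0 c1 c2 b - iquad c0 c1 c2 a.
Proof.
move=> ab /eq_Rintegral_open -> //; last exact: continuous_quad.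
pose P : {poly R} := c0 *: 'X + (c1 / 2) *: 'X^2 + (c2 / 3) *: 'X^3.
have PE t : iquad c0 c1 c2 t = P.[t] by rewrite /iquad /P !(hornerD, hornerZ, hornerX, hornerXn); field.
rewrite /Rintegral (@continuous_FTC2 _ _ (horner P)) //.
- by rewrite !PE.
- exact/continuous_subspaceT/continuous_quad.
- split=> [x _||]; first exact: derivable_horner.
  + by apply: cvg_at_right_filter; exact: continuous_horner.
  + by apply: cvg_at_left_filter; exact: continuous_horner.
move=> x _; rewrite -derivE /P /quad !(derivD, derivZ, derivX, derivXn).
rewrite !(hornerD, hornerZ, hornerX, hornerXn, hornerC, hornerMn) /=.
by field.
Qed.

Lemma Rintegral_same_edge s k f : 0 < s < 1 ->
  (forall t, 0 < t < 1 -> f t = `|s - t| - k * (s - t) ^+ 2) ->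
  \int[lebesgue_measure]_(t in `[0, 1]) f t =
  (s ^+ 2 + (1 - s) ^+ 2) / 2 - k * (s ^+ 3 + (1 - s) ^+ 3) / 3.
Proof.
move=> /andP[s0 s1]; pose h t := `|s - t| - k * (s - t) ^+ 2.
have ch : continuous h.
  move=> t; have cB : {for t, continuous (fun t => s - t)}.
    by apply: cvgB; [exact: cvg_cst|exact: cvg_id].
  apply: cvgB; first exact: cvg_norm.
  by apply: cvgMr; rewrite expr2; under eq_fun do rewrite expr2; apply: cvgM.
move=> /(eq_Rintegral_open ch) ->.
have ih : lebesgue_measure.-integrable `[0, 1] (EFin \o h).
  apply: continuous_compact_integrable; first exact: segment_compact.
  exact: continuous_subspaceT.
(* The integrand has a corner at [s] and is quadratic on either side, so the integral is split
   there. *)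
have /(_ _ _)/eqP := @Rintegral_itvB R h (BLeft 0) (BRight 1) s ih.
rewrite !bnd_simp => /(_ (ltW s0) (ltW s1)); rewrite subr_eq => /eqP ->.
rewrite Rintegral_itv_obnd_cbnd; last first.
  by apply: integrableS ih => //; apply: subset_itvr; rewrite bnd_simp ltW.
rewrite (@Rintegral_quad 0 s _ (s - k * s ^+ 2) (2 * k * s - 1) (- k)) //; last first.
  by move=> t /andP[_ ts]; rewrite /h gtr0_norm ?subr_gt0 // /quad; ring.
rewrite (@Rintegral_quad s 1 _ (- s - k * s ^+ 2) (2 * k * s + 1) (- k)) //; last first.
  by move=> t /andP[st _]; rewrite /h ltr0_norm ?subr_lt0 // /quad; ring.
by rewrite /iquad; field.
Qed.

End Integrals.

Lemma natr_cards (R : pzSemiRingType) (T : finType) (P : pred T) :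
  #|[set x | P x]|%:R = \sum_x (P x)%:R :> R.
Proof.
rewrite cardsE -sum1_card natr_sum big_mkcond /=; apply: eq_bigr => x _.
by rewrite unfold_in; case: (P x).
Qed.

Lemma natr_valence (R : pzSemiRingType) (G : multigraph) (x : vertex G) :
  (valence x)%:R = \sum_(e : edge G) ((src e == x)%:R + (tgt e == x)%:R) :> R.
Proof. by rewrite /valence natrD !natr_cards -big_split. Qed.

(** * The invariant phi in terms of vertex resistances *)

Section PhiFormula.
Variables (R : realType) (X : special_fibre).
Local Notation RX := (reduction_graph R X).
Variables (r : vertex RX -> vertex RX -> R) (K : vertex RX -> R).
Hypothesis rP : resistance_cert r K.
Hypothesis densityE : forall e : edge RX, edge_density e = edge_gap r e.

Local Notation g := ((genus X)%:R : R).
Local Notation q x := ((ggenus (x : vertex X))%:R : R).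
Local Notation k := (edge_gap r).

(* The admissible measure, scaled by [g] and moved to the vertices: the uniform
   measure of an edge is split evenly between its ends. *)
Definition vmass (x : vertex RX) : R :=
  q x + \sum_(e : edge RX) k e / 2 * ((src e == x)%:R + (tgt e == x)%:R).

Definition potential (y : vertex RX) : R := \sum_x vmass x * r x y.
(** Collects the integrals of the quadratic corrections [t * (1 - t) * k e] against the density
    [k e]. *)
Definition gap_sq : R := (\sum_(e : edge RX) k e ^+ 2) / 6.
Definition mass_energy : R := \sum_x vmass x * potential x.
Definition cert_energy : R := \sum_x K x * potential x.

Hypothesis total_mass : \sum_x q x + \sum_e k e = g.
Hypothesis g0 : g != 0.

Let unit_len : forall e : edge RX, len e = 1. Proof. by []. Qed.

(** The mean of an affine function on an edge is the average of its end values; hence [vmass]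
    integrates functions affine along edges exactly as [g mu] does. *)
Lemma sum_vmass (h : vertex RX -> R) :
  \sum_x vmass x * h x = \sum_x q x * h x + \sum_e k e * ((h (src e) + h (tgt e)) / 2).
Proof.
have delta (y : vertex RX) : h y = \sum_x h x * (y == x)%:R.
  by rewrite -[LHS](sum_delta h); apply: eq_bigr => x _; rewrite eq_sym.
under eq_bigr => x _ do rewrite /vmass mulrDl mulr_suml.
rewrite big_split /= exchange_big /=; congr (_ + _); apply: eq_bigr => e _.
rewrite (delta (src e)) (delta (tgt e)) -big_split /= mulr_suml mulr_sumr.
by apply: eq_bigr => x _; ring.
Qed.

Lemma total_vmass : \sum_x vmass x = g.
Proof.
rewrite -total_mass; have := sum_vmass (fun=> 1).
under eq_bigr => x _ do rewrite mulr1.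
under [X in _ = X + _]eq_bigr => x _ do rewrite mulr1.
move=> ->; congr (_ + _); apply: eq_bigr => e _; by field.
Qed.

Lemma mu_integral_quad (f : gpoint RX -> R) (c0 c1 c2 : edge RX -> R) :
  (forall e t, 0 < t < 1 -> f (inr (e, t)) = quad (c0 e) (c1 e) (c2 e) t) ->
  mu_integral f = g^-1 * (\sum_(x : vertex RX) q x * f (inl x) +
                          \sum_e k e * (c0 e + c1 e / 2 + c2 e / 3)).
Proof.
move=> fE; rewrite /mu_integral; congr (_ * (_ + _)); apply: eq_bigr => e _.
rewrite densityE (Rintegral_quad _ (fE e)) //; congr (_ * _).
by rewrite /iquad; field.
Qed.

Lemma mu_resistance_vertex y :
  mu_integral (fun p => resistance (inl y : gpoint RX) p) = g^-1 * (potential y + gap_sq).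
Proof.
rewrite (@mu_integral_quad _ (fun e => r (src e) y)
  (fun e => r (tgt e) y - r (src e) y + k e) (fun e => - k e)); last first.
  by move=> e t t01; rewrite (resistance_ve unit_len rP) // /edge_profile /quad; ring.
rewrite /potential sum_vmass /gap_sq mulr_suml -!addrA -big_split /=; congr (_ * (_ + _)).
  by apply: eq_bigr => x _; rewrite (resistance_vv rP); have [_ -> _ _] := rP.
by apply: eq_bigr => e _; field.
Qed.

Lemma mu_resistance_edge e s : 0 < s < 1 ->
  mu_integral (fun p => resistance (inr (e, s) : gpoint RX) p) =
  g^-1 * ((1 - s) * potential (src e) + s * potential (tgt e) +
          s * (1 - s) * k e * (g - 1) + gap_sq).
Proof.
move=> s01; rewrite /mu_integral; congr (_ * _).
have [r0 rC _ _] := rP.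
have -> : \sum_(x : vertex RX) q x * resistance (inr (e, s) : gpoint RX) (inl x) =
          \sum_x q x * edge_profile r e s x.
  by apply: eq_bigr => x _; rewrite (resistance_ev unit_len rP).
(* [avg f] is the integral over an edge [f] other than [e]. On [e] itself the same expression is too
   large by [s * (1 - s)], which turns the factor [g] of [s * (1 - s) * k e] into [g - 1]. *)
pose avg f := (edge_profile r e s (src f) + edge_profile r e s (tgt f)) / 2 + k f / 6.
have int f : \int[lebesgue_measure]_(t in `[0, len f])
    resistance (inr (e, s) : gpoint RX) (inr (f, t)) = avg f - (f == e)%:R * (s * (1 - s)).
  have [->|fe] := eqVneq f e.
    rewrite (Rintegral_same_edge s01 (k := k e)); last first.
      by move=> t t01; rewrite (resistance_same unit_len rP).
    by rewrite mul1r /avg /edge_profile !r0 (rC (tgt e) (src e)) /edge_gap; field.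
  rewrite (@Rintegral_quad _ 0 1 _ (edge_profile r e s (src f))
    (edge_profile r e s (tgt f) - edge_profile r e s (src f) + k f) (- k f)) //; last first.
    move=> t t01; rewrite (resistance_ee unit_len rP) // 1?eq_sym // /quad; ring.
  by rewrite mul0r /iquad /avg; field.
under [X in _ + X]eq_bigr => f _ do rewrite int densityE.
have -> : \sum_f k f * (avg f - (f == e)%:R * (s * (1 - s))) =
   \sum_f k f * avg f - k e * (s * (1 - s)).
  transitivity (\sum_f (k f * avg f - (k f * (s * (1 - s))) * (f == e)%:R)).
    by apply: eq_bigr => f _; ring.
  rewrite sumrB; congr (_ - _).
  rewrite (bigD1 e) //= eqxx mulr1 big1 ?addr0 // => f fe.
  by rewrite (negbTE fe) mulr0.
have -> : \sum_f k f * avg f =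
  \sum_f k f * ((edge_profile r e s (src f) + edge_profile r e s (tgt f)) / 2) + gap_sq.
  rewrite /gap_sq mulr_suml -big_split /=; apply: eq_bigr => f _; rewrite /avg; ring.
rewrite !addrA -sum_vmass.
have -> : \sum_x vmass x * edge_profile r e s x =
  (1 - s) * potential (src e) + s * potential (tgt e) + s * (1 - s) * k e * g.
  rewrite /potential -total_vmass !mulr_sumr -!big_split /=; apply: eq_bigr => x _.
  by rewrite /edge_profile (rC x) (rC x); ring.
by ring.
Qed.

Let I : R := g^-1 ^+ 2 * (mass_energy + (2 * g - 1) * gap_sq).

Lemma mu_mu_resistance :
  mu_integral (fun p : gpoint RX => mu_integral (fun p' => resistance p p')) = I.
Proof.
rewrite (@mu_integral_quad _
  (fun e => g^-1 * (potential (src e) + gap_sq))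
  (fun e => g^-1 * (potential (tgt e) - potential (src e) + k e * (g - 1)))
  (fun e => - (g^-1 * (k e * (g - 1))))); last first.
  by move=> e t t01; rewrite mu_resistance_edge // /quad; ring.
under eq_bigr => x _ do rewrite mu_resistance_vertex.
have -> : \sum_(x : vertex RX) q x * (g^-1 * (potential x + gap_sq)) =
  g^-1 * (\sum_x q x * potential x + (\sum_x q x) * gap_sq).
  rewrite mulr_suml -big_split mulr_sumr /=; apply: eq_bigr => x _; ring.
have -> : \sum_e k e * (g^-1 * (potential (src e) + gap_sq) +
    g^-1 * (potential (tgt e) - potential (src e) + k e * (g - 1)) / 2 +
    - (g^-1 * (k e * (g - 1))) / 3) =
  g^-1 * (\sum_e k e * ((potential (src e) + potential (tgt e)) / 2) +
          (\sum_e k e) * gap_sq + gap_sq * (g - 1)).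
  rewrite [in gap_sq * (g - 1)]/gap_sq !mulr_suml -!big_split mulr_sumr /=; apply: eq_bigr => e _; by field.
rewrite /I /mass_energy sum_vmass (_ : \sum_x q x = g - \sum_e k e); last first.
  by rewrite -total_mass addrK.
by ring.
Qed.

(** The resistance part of the Green function has integral [I], and the constant [I / 2] is
    subtracted against a measure of total mass one. *)
Lemma mu_green_diag : mu_integral (fun p : gpoint RX => green_diag p) = I / 2.
Proof.
rewrite (@mu_integral_quad _
  (fun e => g^-1 * (potential (src e) + gap_sq) - 2^-1 * I)
  (fun e => g^-1 * (potential (tgt e) - potential (src e) + k e * (g - 1)))
  (fun e => - (g^-1 * (k e * (g - 1))))); last first.
  by move=> e t t01; rewrite /green_diag mu_mu_resistance mu_resistance_edge // /quad; ring.
under eq_bigr => x _ do rewrite /green_diag mu_mu_resistance mu_resistance_vertex.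
have -> : \sum_(x : vertex RX) q x * (g^-1 * (potential x + gap_sq) - 2^-1 * I) =
  g^-1 * (\sum_x q x * potential x + (\sum_x q x) * gap_sq) - (\sum_x q x) * (2^-1 * I).
  rewrite mulr_suml -big_split [in RHS]mulr_sumr [X in _ - X]mulr_suml -sumrB /=.
  by apply: eq_bigr => x _; ring.
have -> : \sum_e k e * (g^-1 * (potential (src e) + gap_sq) - 2^-1 * I +
    g^-1 * (potential (tgt e) - potential (src e) + k e * (g - 1)) / 2 +
    - (g^-1 * (k e * (g - 1))) / 3) =
  g^-1 * (\sum_e k e * ((potential (src e) + potential (tgt e)) / 2) +
          (\sum_e k e) * gap_sq + gap_sq * (g - 1)) - (\sum_e k e) * (2^-1 * I).
  rewrite [in gap_sq * (g - 1)]/gap_sq !mulr_suml -!big_split [in RHS]mulr_sumr -sumrB /=.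
  by apply: eq_bigr => e _; field.
rewrite (_ : \sum_x q x = g - \sum_e k e); last by rewrite -total_mass addrK.
by rewrite /I /mass_energy sum_vmass; field.
Qed.

(** A Laplacian sums to zero, so [K] balances the point mass 2 at the pole [y]. *)
Lemma sum_cert_mass (y : vertex RX) : \sum_z K z = 2.
Proof.
have [r0 rC _ rK] := rP.
have : \sum_z \sum_e bdry z e * ((r (src e) y - r (tgt e) y) / len e) = 0.
  rewrite exchange_big big1 //= => e _; rewrite -mulr_suml.
  have := @sum_vertex_bdry R RX (fun=> 1) e; under eq_bigr => z _ do rewrite mul1r.
  by move=> ->; rewrite subrr mul0r.
under eq_bigr => z _ do rewrite rK.
rewrite sumrB => /eqP; rewrite subr_eq0 => /eqP ->.
by rewrite (sum_delta (fun=> 2) y).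
Qed.

(** Evaluating the Laplacian of [r (-, x)] at the pole itself sees only edges at [x], each
    contributing its own resistance [1 - k e]; this expresses [K x] through the valence and the
    gaps. *)
Lemma canonicalE (x : vertex RX) : (valence x)%:R - 2 + 2 * q x = 2 * vmass x - K x.
Proof.
have [r0 rC _ rK] := rP.
have := rK x x; rewrite eqxx mulr1 => Kx.
have -> : K x = 2 - \sum_e ((src e == x)%:R + (tgt e == x)%:R) * (1 - k e).
  rewrite -[K x](subrK 2) -Kx addrC -sumrN; congr (_ + _); apply: eq_bigr => e _.
  rewrite /bdry /edge_gap divr1.
  by case: eqP => [->|_]; case: eqP => [->|_]; rewrite ?r0 ?(rC x (tgt e)) /=; ring.
rewrite natr_valence /vmass mulrDr mulr_sumr.
have -> : \sum_e ((src e == x)%:R + (tgt e == x)%:R) * (1 - k e) =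
  \sum_(e : edge RX) ((src e == x)%:R + (tgt e == x)%:R) -
  \sum_(e : edge RX) 2 * (k e / 2 * ((src e == x)%:R + (tgt e == x)%:R)).
  by rewrite -sumrB; apply: eq_bigr => e _; field.
by ring.
Qed.

Lemma K_green_diag (y : vertex RX) : K_integral (fun p : gpoint RX => green_diag p) =
  g^-1 * (2 * mass_energy - cert_energy + (2 * g - 2) * gap_sq) - (g - 1) * I.
Proof.
rewrite /K_integral.
under eq_bigr => x _ do
  rewrite canonicalE /green_diag mu_mu_resistance mu_resistance_vertex.
transitivity (g^-1 * (2 * (\sum_x vmass x * potential x) - \sum_x K x * potential x) +
  (2 * (\sum_x vmass x) - \sum_x K x) * (g^-1 * gap_sq - 2^-1 * I)); last first.
  rewrite total_vmass (sum_cert_mass y) /mass_energy /cert_energy; by field.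
rewrite !mulr_sumr -!sumrB mulr_sumr mulr_suml -big_split /=.
by apply: eq_bigr => x _; ring.
Qed.

Lemma phiE (y : vertex RX) : phi R X =
  - (#|edge X|%:R / 4) + mass_energy / g + cert_energy / (4 * g) +
  (5 * g - 2) * gap_sq / (2 * g).
Proof.
rewrite /phi /total_length (K_green_diag y) mu_green_diag /I.
rewrite (eq_bigr (fun=> 1)) // sumr_const cardT -cardE.
by field.
Qed.

End PhiFormula.

(** * Circles in elementary graphs *)

Section Circles.
Variable G : multigraph.
Implicit Types (x y z A B : vertex G) (e f : edge G) (F C : {set edge G}).
Implicit Types (d : edge G * bool) (s t : seq (edge G * bool)).

Lemma joinsC e x y : joins e x y = joins e y x.
Proof. by rewrite /joins orbC. Qed.

Lemma adj_sym F : symmetric (adj F).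
Proof. by move=> x y; apply: eq_existsb => e; rewrite joinsC. Qed.

Lemma adjC F : connect_sym (adj F).
Proof. exact/sym_connect_sym/adj_sym. Qed.

Lemma adj_edge F e : e \in F -> adj F (src e) (tgt e).
Proof. by move=> eF; apply/existsP; exists e; rewrite eF /joins !eqxx. Qed.

Lemma connect_inv (T : finType) (r : rel T) (P : pred T) (x y : T) :
  (forall u w, P u -> r u w -> P w) -> P x -> connect r x y -> P y.
Proof.
move=> Pr Px /connectP[p + ->]; elim: p x Px => //= w p IH x Px /andP[xw].
by apply: IH; apply: Pr xw.
Qed.

Fixpoint walk x s y : bool :=
  if s is d :: s' then (dtail d == x) && walk (dhead d) s' y else x == y.

Lemma walk_cat x y z s t : walk x s y -> walk y t z -> walk x (s ++ t) z.
Proof.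
elim: s x => /= [x /eqP -> //|d s IH x /andP[-> w] wt].
exact: IH.
Qed.

Lemma walk_split x y s d t :
  walk x (s ++ d :: t) y -> walk x s (dtail d) /\ walk (dtail d) (d :: t) y.
Proof.
elim: s x => /= [x /andP[/eqP <- ->]|d' s IH x /andP[-> /IH[-> ->]]] //.
by rewrite !eqxx.
Qed.

Lemma walk_cycle d s :
  cycle (fun d d' => dhead d == dtail d') (d :: s) = walk (dhead d) s (dtail d).
Proof.
rewrite /cycle; have: forall d0, path (fun d d' => dhead d == dtail d') d0 (rcons s d) =
   walk (dhead d0) s (dtail d); last exact.
by elim: s => /= [|a s IH] d0; rewrite ?andbT // IH eq_sym.
Qed.

Lemma walk_connect F x y s :
  walk x s y -> {in s, forall d, d.1 \in F} -> connect (adj F) x y.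
Proof.
elim: s x => /= [x /eqP -> _|d s IH x /andP[/eqP <- w] sF]; first exact: connect0.
apply: (@connect_trans _ _ (dhead d)); last first.
  by apply: IH => // d' d's; apply: sF; rewrite inE d's orbT.
have dF : d.1 \in F by apply: sF; rewrite inE eqxx.
rewrite /dhead /dtail; case: d.2; last rewrite adjC; exact/connect1/adj_edge.
Qed.

Lemma path_walk F x p : path (adj F) x p -> exists s,
  [/\ walk x s (last x p), [seq dtail d | d <- s] = belast x p &
      {in s, forall d, d.1 \in F}].
Proof.
elim: p x => /= [|y p IH] x; first by exists [::]; split=> /=.
move=> /andP[/existsP[e /andP[eF exy]] /IH[s [w ts sF]]].
have [d [dx dy de]] : exists d, [/\ dtail d = x, dhead d = y & d.1 = e].
  case/orP: exy => /andP[/eqP <- /eqP <-]; first by exists (e, true).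
  by exists (e, false).
exists (d :: s); split; first by rewrite /= dx dy eqxx.
  by rewrite /= ts dx.
by move=> d'; rewrite inE => /predU1P[->|/sF //]; rewrite de.
Qed.

Lemma walk_heads x s y d : walk x s y -> d \in s ->
  dhead d \in rcons [seq dtail d | d <- s] y.
Proof.
elim: s x => //= a s IH x /andP[_ w]; rewrite !inE => /predU1P[->|ds].
  by case: s w {IH} => /= [/eqP ->|b s /andP[/eqP -> _]]; rewrite inE eqxx ?orbT.
by rewrite (IH _ w ds) orbT.
Qed.

Lemma dart_ends d d' : d.1 = d'.1 ->
  (dtail d == dtail d') || (dtail d == dhead d').
Proof. by rewrite /dtail /dhead => ->; case: d.2; case: d'.2; rewrite !eqxx ?orbT. Qed.

(** A second use of an edge would return to the tail of its first use. The end [y] is included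
    because going forth and back along one edge has distinct tails. *)
Lemma walk_edges_uniq x s y : walk x s y ->
  uniq (rcons [seq dtail d | d <- s] y) -> uniq [seq d.1 | d <- s].
Proof.
elim: s x => //= d s IH x /andP[_ w] /andP[dn us]; rewrite (IH _ w us) andbT.
apply: contra dn => /mapP[d' d's /dart_ends/orP[]/eqP ->]; last exact: walk_heads w d's.
by rewrite mem_rcons inE map_f ?orbT.
Qed.

Definition circle_walk C A s : Prop :=
  [/\ s != [::], walk A s A, uniq [seq dtail d | d <- s], uniq [seq d.1 | d <- s] &
      C = [set e in [seq d.1 | d <- s]]].

Lemma circleP C : circle C <-> exists A s, circle_walk C A s.
Proof.
split=> [[[|d s] [// s0 cs us ue ->]]|[A [[|d s] [// s0 ws us ue ->]]]].
  exists (dtail d), (d :: s); split=> //.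
  by move: cs; rewrite walk_cycle /= eqxx.
exists (d :: s); split=> //; rewrite walk_cycle.
by case/andP: ws => /eqP ->.
Qed.

Lemma circle_walk_ends C A s : circle_walk C A s ->
  ends C =i [seq dtail d | d <- s].
Proof.
case=> s0 ws us ue -> x; apply/idP/idP.
  have dt d : d \in s -> dtail d \in [seq dtail d | d <- s] by exact: map_f.
  have dh d : d \in s -> dhead d \in [seq dtail d | d <- s].
    move=> /(walk_heads ws); rewrite mem_rcons inE => /predU1P[->|//].
    by case: s s0 ws {us ue dt} => //= a s _ /andP[/eqP -> _]; rewrite inE eqxx.
  rewrite inE => /orP[]/imsetP[e]; rewrite inE => /mapP[[e' []] ds /= -> ->].
  - exact: (dt (e', true)).
  - exact: (dh (e', false)).
  - exact: (dh (e', true)).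
  - exact: (dt (e', false)).
move=> /mapP[d ds ->].
have eC : d.1 \in [set e in [seq d.1 | d <- s]] by rewrite inE map_f.
by rewrite inE /dtail; case: d.2; rewrite imset_f ?orbT.
Qed.

Lemma circle_walk_rot C A s t d : circle_walk C A (s ++ d :: t) ->
  circle_walk C (dtail d) (d :: t ++ s).
Proof.
case=> s0 /walk_split[w1 w2] us ue ->.
have pq : perm_eq (s ++ d :: t) (d :: t ++ s) by rewrite perm_catC.
split=> //.
- by have := walk_cat w2 w1.
- by rewrite -(perm_uniq (perm_map (@dtail G) pq)).
- by rewrite -(perm_uniq (perm_map fst pq)).
by apply/setP => e; rewrite !inE (perm_mem (perm_map fst pq)).
Qed.

Lemma circle_at C A : circle C -> A \in ends C -> exists s, circle_walk C A s.
Proof.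
move=> /circleP[B [s sC]]; rewrite (circle_walk_ends sC) => /mapP[d /splitPr ds ->].
by case: ds sC => s1 s2 /circle_walk_rot sC; exists (d :: s2 ++ s1).
Qed.

(* Two such vertices, taken consecutive on the path, would close up a circle
   sharing an edge with [C]. *)
Lemma elementary_off_circle C A B : elementary G -> circle C ->
  A \in ends C -> B \in ends C -> connect (adj (~: C)) A B -> A = B.
Proof.
move=> elem cC AC BC /connectP[p0 p0C p0B]; apply/eqP/negPn/negP => AB.
case/shortenP: p0C p0B => p pC pu _ pB.
have : has (mem (ends C)) p.
  apply/hasP; exists B => //; rewrite pB; case: p pB {pC pu} => [/eqP|y p _].
    by rewrite eq_sym (negbTE AB).
  exact: (mem_last y p).
(* [B'] is the first vertex after [A] at which the path returns to [C], so the vertices [p1] in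
   between avoid [C]. *)
move=> hp; case/split_find: hp pC pu pB => B' p1 p2 B'C p1C pC pu pB.
rewrite -cats1 -catA cat_path in pC; case/andP: pC => p1p /andP[pB' _].
have pC : path (adj (~: C)) A (rcons p1 B') by rewrite rcons_path p1p.
have pu' : uniq (A :: rcons p1 B').
  by move: pu; rewrite -!cat_cons cat_uniq => /and3P[].
have [t [wt tt tC]] := path_walk pC.
rewrite last_rcons belast_rcons in wt tt.
have AB' : A != B' by move: pu' => /= /andP[]; rewrite mem_rcons inE negb_or => /andP[].
have [s sC] := circle_at cC AC.
have := B'C; rewrite -[mem _ _]/(B' \in ends C) (circle_walk_ends sC) => /mapP[d ds dB'].
have ends_s := circle_walk_ends sC.
case/splitPr: ds sC ends_s => s1 s2 sC ends_s.
case: sC => _ /walk_split[w1 w2] us ue defC.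
have s1A : A \in [seq dtail d | d <- s1].
  case: s1 w1 {us ue defC ends_s} => [/eqP|a s1 /=]; first by rewrite -dB' => /eqP; rewrite (negbTE AB').
  by case/andP => /eqP <- _; rewrite inE eqxx.
have tneq : t != [::] by case: t wt {tt tC} => //= /eqP /eqP; rewrite (negbTE AB').
have eC d' : d' \in d :: s2 -> d'.1 \in C.
  by move=> d's; rewrite defC inE map_f // mem_cat d's orbT.
(* The second circle follows the path off [C] from [A] to [B'] and then the arc of [C] from [B']
   back to [A]. *)
have cC' : circle [set e in [seq d.1 | d <- t ++ d :: s2]].
  apply/circleP; exists A, (t ++ d :: s2); split=> //.
  - by case: (t) tneq.
  - by apply: walk_cat wt _; rewrite dB'.
  - rewrite map_cat cat_uniq tt.
    move: us; rewrite map_cat cat_uniq => /and3P[_ disj ->]; rewrite andbT.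
    have uAp1 : uniq (A :: p1) by move: pu'; rewrite -rcons_cons rcons_uniq => /andP[].
    rewrite uAp1 andTb; apply/hasPn => z zs; rewrite inE negb_or; apply/andP; split.
      by apply/eqP => zA; case/hasP: disj; exists z => //; rewrite zA.
    apply: contra p1C => zp1; apply/hasP; exists z => //=.
    by rewrite ends_s map_cat mem_cat zs orbT.
  - rewrite map_cat cat_uniq (walk_edges_uniq wt) ?tt // andTb.
    move: ue; rewrite map_cat cat_uniq => /and3P[_ _ ->]; rewrite andbT.
    apply/hasPn => e /mapP[d' /eC d'C ->]; apply/mapP => -[d'' /tC].
    by rewrite inE => /negP d''C E; apply: d''C; rewrite -E.
have dC : d.1 \in C by apply: eC; rewrite inE eqxx.
(* Both circles contain the first edge [d] of the arc, hence coincide; but the first edge of the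
   path lies off [C]. *)
have CC' : C = [set e in [seq d.1 | d <- t ++ d :: s2]].
  by apply: (elem d.1) => //; rewrite inE map_f // mem_cat inE eqxx orbT.
case: t tneq tC {wt tt cC'} CC' => //= a t _ /(_ a); rewrite inE eqxx => /(_ isT) aC CC'.
by move: aC; rewrite inE CC' inE inE eqxx.
Qed.

Lemma nonsep_circle e : connect (adj (~: [set e])) (src e) (tgt e) ->
  exists2 C, circle C & e \in C.
Proof.
rewrite adjC => /connectP[p0 p0e p0l]; case/shortenP: p0e p0l => p pe pu _ pl.
have [t [wt tt te]] := path_walk pe; rewrite -pl in wt.
exists [set f in [seq d.1 | d <- (e, true) :: t]]; last by rewrite inE inE eqxx.
apply/circleP; exists (src e), ((e, true) :: t).
have ut : uniq (rcons [seq dtail d | d <- t] (src e)) by rewrite tt pl -lastI.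
split=> //=; first by rewrite eqxx.
  by move: ut; rewrite rcons_uniq.
rewrite (walk_edges_uniq wt ut) andbT; apply/mapP => -[d /te].
by rewrite !inE => /eqP ne E; apply: ne.
Qed.

Lemma circle_nonsep C e : circle C -> e \in C ->
  connect (adj (~: [set e])) (src e) (tgt e).
Proof.
move=> /circleP[A [s sC]] eC.
have : e \in [seq d.1 | d <- s] by case: sC eC => _ _ _ _ ->; rewrite inE.
case/mapP => d /splitPr ds ->; case: ds sC => s1 s2 /circle_walk_rot[_ w _ /= ue _].
case/andP: w => _ w; case/andP: ue => ue _.
have : connect (adj (~: [set d.1])) (dhead d) (dtail d).
  apply: walk_connect w _ => d' d's; rewrite !inE; apply: contra ue => /eqP <-.
  exact: map_f.
by rewrite /dhead /dtail; case: d.2 => //; rewrite adjC.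
Qed.

End Circles.

(** * Cyclic coordinates on a circle and the retraction onto it *)

Section CircleCharts.
Variable G : multigraph.
Implicit Types (x y z : vertex G) (e f : edge G) (C : {set edge G}).

(* The circle [C] with its vertices [v i] and edges [ed i] in cyclic order, and
   the retraction [pos] of the graph onto (the vertices of) [C]. *)
Record circle_chart C n (v : 'I_n.+1 -> vertex G) (ed : 'I_n.+1 -> edge G)
    (pos : vertex G -> 'I_n.+1) : Prop := CircleChart {
  chart_v_inj : injective v;
  chart_e_inj : injective ed;
  chart_joins : forall i, joins (ed i) (v i) (v (i + inZp 1));
  chart_edges : C = [set ed i | i : 'I_n.+1];
  chart_pos : forall i x, connect (adj (~: C)) (v i) x = (pos x == i) }.

Lemma circle_index C : circle C ->
  exists n (v : 'I_n.+1 -> vertex G) (ed : 'I_n.+1 -> edge G),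
  [/\ injective v, injective ed, forall i, joins (ed i) (v i) (v (i + inZp 1)) &
      C = [set ed i | i : 'I_n.+1]].
Proof.
case=> -[[]//|d s [_ cs us ue ->]].
exists (size s), (fun i => dtail (nth d (d :: s) i)), (fun i => (nth d (d :: s) i).1).
split.
- move=> i j /eqP; rewrite -!(nth_map d (dtail d) (@dtail G)) //.
  by rewrite nth_uniq ?size_map // => /eqP/val_inj.
- move=> i j /eqP; rewrite -!(nth_map d d.1 fst) //.
  by rewrite nth_uniq ?size_map // => /eqP/val_inj.
- move=> i; set d' := nth d (d :: s) (i + inZp 1)%R.
  have /eqP <- : dhead (nth d (d :: s) i) == dtail d'.
    have := pathP d cs i; rewrite size_rcons ltn_ord => /(_ isT).
    have -> : nth d (d :: rcons s d) i = nth d (d :: s) i.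
      by rewrite -rcons_cons nth_rcons /= ltn_ord.
    suff -> : nth d (rcons s d) i = d' by [].
    (* Addition of indices is modulo the length: the last dart is followed by the first, which
       [rcons] appends at the end. *)
    rewrite /d' /= modnDmr addn1 nth_rcons.
    have [ls|] := ltnP i (size s); first by rewrite modn_small.
    rewrite leq_eqVlt ltnNge -ltnS ltn_ord orbF => /eqP <-.
    by rewrite eqxx modnn.
  by rewrite /joins /dhead /dtail; case: (_.2); rewrite !eqxx ?orbT.
apply/setP => e; rewrite inE; apply/idP/imsetP.
  case/mapP => d' d's ->; have lt : (index d' (d :: s) < (size s).+1)%N.
    by rewrite -[(size s).+1]/(size (d :: s)) index_mem.
  by exists (Ordinal lt); rewrite //= nth_index.
by case=> i _ ->; rewrite map_f // mem_nth.
Qed.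

Lemma chart_ends C n (v : 'I_n.+1 -> vertex G) (ed : 'I_n.+1 -> edge G) :
  (forall i, joins (ed i) (v i) (v (i + inZp 1))) ->
  C = [set ed i | i : 'I_n.+1] -> ends C = [set v i | i : 'I_n.+1].
Proof.
move=> jn ->; apply/setP => x; apply/idP/imsetP.
  rewrite inE => /orP[]/imsetP[e /imsetP[i _ ->] ->]; case/orP: (jn i) => /andP[/eqP h1 /eqP h2].
  - by exists i.
  - by exists (i + inZp 1).
  - by exists (i + inZp 1).
  - by exists i.
case=> i _ ->; rewrite inE; have ei : ed i \in [set ed i | i : 'I_n.+1] by apply: imset_f.
case/orP: (jn i) => /andP[/eqP h1 /eqP h2]; apply/orP; [left|right]; apply/imsetP;
  by exists (ed i).
Qed.

Hypothesis connG : connected_graph G.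
Hypothesis elemG : elementary G.

(** Connectedness lets every vertex be reached off [C] from some [v i], and [elementary_off_circle]
    makes this [i] unique; it becomes [pos]. *)
Lemma circle_chart_exists C : circle C ->
  exists n (v : 'I_n.+1 -> vertex G) (ed : 'I_n.+1 -> edge G) pos,
    circle_chart C v ed pos.
Proof.
move=> cC; have [n [v [ed [vi ei jn defC]]]] := circle_index cC.
have endsE := chart_ends jn defC.
have v_end i : v i \in ends C by rewrite endsE imset_f.
have ex x : exists i, connect (adj (~: C)) (v i) x.
  suff : [exists i, connect (adj (~: C)) (v i) x] by move/existsP.
  apply: (@connect_inv _ _ (fun y => [exists i, connect (adj (~: C)) (v i) y]) _ _ _ _
    (connG (v 0) x)) => [y z /existsP[i iy] /existsP[e /andP[_ eyz]]|].
    have [eC|eC] := boolP (e \in C).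
      have : z \in ends C.
        by rewrite inE; case/orP: eyz => /andP[/eqP ey /eqP ez]; rewrite -?ey -?ez imset_f ?orbT.
      by rewrite endsE => /imsetP[j _ ->]; apply/existsP; exists j; exact: connect0.
    apply/existsP; exists i; apply: connect_trans iy (connect1 _).
    by apply/existsP; exists e; rewrite inE eC.
  by apply/existsP; exists 0; exact: connect0.
exists n, v, ed, (fun x => xchoose (ex x)); split=> // i x.
have xP := xchooseP (ex x); apply/idP/eqP => [ix|<- //].
apply: vi; apply: (elementary_off_circle elemG cC) => //.
by apply: connect_trans xP _; rewrite adjC.
Qed.

End CircleCharts.

Section ChartTheory.
Variables (G : multigraph) (C : {set edge G}) (n : nat).
Variables (v : 'I_n.+1 -> vertex G) (ed : 'I_n.+1 -> edge G) (pos : vertex G -> 'I_n.+1).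
Hypothesis ch : circle_chart C v ed pos.

Lemma chart_pos_v i : pos (v i) = i.
Proof. by apply/eqP; rewrite -(chart_pos ch) connect0. Qed.

Lemma chart_pos_edge e : e \notin C -> pos (src e) = pos (tgt e).
Proof.
move=> eC; apply/esym/eqP; rewrite -(chart_pos ch).
have : connect (adj (~: C)) (v (pos (src e))) (src e) by rewrite (chart_pos ch).
by move=> /connect_trans; apply; apply/connect1/adj_edge; rewrite inE.
Qed.

Lemma chart_card : #|C| = n.+1.
Proof.
by rewrite (chart_edges ch) card_imset ?card_ord //; exact: chart_e_inj ch.
Qed.

Lemma chart_mem x : (x \in ends C) = (v (pos x) == x).
Proof.
rewrite (chart_ends (chart_joins ch) (chart_edges ch)).
apply/imsetP/eqP => [[i _ ->]|xE]; first by rewrite chart_pos_v.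
by exists (pos x).
Qed.

Lemma chart_sum (R : nmodType) (F : edge G -> R) :
  \sum_(e in C) F e = \sum_i F (ed i).
Proof.
rewrite (chart_edges ch) big_imset /=; first by apply: eq_bigl => i; rewrite inE.
by move=> i j _ _ /(chart_e_inj ch).
Qed.

(** A path off [C] starting at [v i] stays where [pos] is [i], so it meets no other vertex of [C]
    and the extra restrictions in [branch_core] hold along it. *)
Lemma chart_branch_core i : branch_core C (v i) = [set x | pos x == i].
Proof.
apply/setP => x; rewrite !inE -(chart_pos ch); apply/idP/idP.
  by apply: connect_sub => y z /and3P[_ _ yz]; exact: connect1.
move=> ix; set rel_core := (X in connect X).
pose P y := connect (adj (~: C)) (v i) y && connect rel_core (v i) y.
suff : P x by case/andP.
apply: (@connect_inv _ _ P _ _ _ _ ix) => [y z /andP[iy cy] yz|]; last by rewrite /P !connect0.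
  have iz : connect (adj (~: C)) (v i) z by apply: connect_trans iy (connect1 _).
  have off w : connect (adj (~: C)) (v i) w -> (w == v i) || (w \notin ends C).
    rewrite (chart_pos ch) chart_mem => /eqP ->.
    by rewrite eq_sym orbN.
  by rewrite /P iz; apply: connect_trans cy (connect1 _); rewrite /rel_core !off.
Qed.

Lemma chart_branch_edges i :
  branch_edges C (v i) = [set f | (f \notin C) && (pos (src f) == i)].
Proof.
apply/setP => e; rewrite [LHS]inE chart_branch_core !inE.
by case: (boolP (e \in C)) => //= eC; rewrite (chart_pos_edge eC) orbb.
Qed.

Lemma chart_branch_vertices i : branch_vertices C (v i) = [set x | pos x == i].
Proof.
rewrite /branch_vertices chart_branch_core chart_branch_edges.
apply/finset.setUidPl/fintype.subsetP => x; rewrite !inE => /orP[]/imsetP[e].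
  by rewrite inE => /andP[_ h] ->.
by rewrite inE => /andP[eC h] ->; rewrite -chart_pos_edge.
Qed.

End ChartTheory.

(** * The resistance kernel of a cycle *)

Section CircleKernel.
Variables (R : realType) (n : nat).
Local Notation ell := (n.+1%:R : R).

(* Effective resistance between two points at distance [m] on a circle of
   length [n.+1]. *)
Definition circ (m : 'I_n.+1) : R := m%:R * (ell - m%:R) / ell.

Let ell0 : ell != 0. Proof. by rewrite pnatr_eq0. Qed.

Lemma circ0 : circ 0 = 0. Proof. by rewrite /circ !mul0r. Qed.

Lemma circN m : circ (- m) = circ m.
Proof.
rewrite /circ /=; case: m => -[|m] lt /=; first by rewrite subn0 modnn.
rewrite modn_small ?ltn_subrL // natrB 1?ltnW //; ring.
Qed.

(** No reduction modulo [n.+1] appears on the right because the parabola vanishes at [ell] as well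
    as at 0. *)
Lemma circS (m : 'I_n.+1) : circ (m + inZp 1) = m.+1%:R * (ell - m.+1%:R) / ell.
Proof.
rewrite /circ /= modnDmr addn1; have [lt|] := ltnP m.+1 n.+1.
  by rewrite modn_small.
rewrite leq_eqVlt ltnNge (ltn_ord m) orbF => /eqP <-.
by rewrite modnn subrr mulr0 !mul0r.
Qed.

Lemma circ1 : circ (inZp 1) = 1 - ell^-1.
Proof. by rewrite -[inZp 1]add0r circS /=; field. Qed.

(** Away from 0 this is the constant second difference of a parabola; the corner at 0 produces the
    point mass. *)
Lemma circ_laplace m :
  2 * circ m - circ (m + inZp 1) - circ (m - inZp 1) = 2 / ell - 2 * (m == 0)%:R.
Proof.
have -> : circ (m - inZp 1) = circ (- m + inZp 1) by rewrite -circN opprB addrC.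
rewrite !circS; have [->|m0] := eqVneq m 0; first by rewrite oppr0 circ0 /=; field.
have m_gt0 : (0 < m)%N by rewrite lt0n; apply: contra m0 => /eqP m0; apply/eqP/val_inj.
rewrite /circ /= modn_small ?ltn_subrL ?m_gt0 // -!natr1 natrB 1?ltnW //.
by rewrite -!natr1; field; rewrite natr1.
Qed.

Lemma circ_ge0 m : 0 <= circ m.
Proof. by rewrite /circ divr_ge0 // mulr_ge0 // subr_ge0 ler_nat ltnW. Qed.

Lemma circ_gt0 m : m != 0 -> 0 < circ m.
Proof.
move=> m0; have m_gt0 : (0 < m)%N.
  by rewrite lt0n; apply: contra m0 => /eqP m0; apply/eqP/val_inj.
by rewrite /circ divr_gt0 ?ltr0n // mulr_gt0 ?ltr0n // subr_gt0 ltr_nat.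
Qed.

Lemma circ_sum : \sum_m circ m = (ell ^+ 2 - 1) / 6.
Proof.
have aux k : \sum_(i < k) (i%:R * (ell - i%:R) : R) =
    ell * (k%:R * (k%:R - 1)) / 2 - k%:R * (k%:R - 1) * (2 * k%:R - 1) / 6.
  elim: k => [|k IH]; first by rewrite big_ord0; field.
  by rewrite big_ord_recr /= IH -!natr1; field.
rewrite -mulr_suml (aux n.+1); by field.
Qed.

Lemma circ_sum_shift j : \sum_m circ (m - j) = (ell ^+ 2 - 1) / 6.
Proof.
rewrite -circ_sum (reindex (fun m => m + j)); last first.
  by exists (fun m => m - j) => m _; rewrite ?addrK ?subrK.
by apply: eq_bigr => m _; rewrite addrK.
Qed.

Lemma circ_sum_shiftr i : \sum_m circ (i - m) = (ell ^+ 2 - 1) / 6.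
Proof.
rewrite -(circ_sum_shift i); apply: eq_bigr => m _.
by rewrite -circN opprB.
Qed.

End CircleKernel.

Section ChartDirichlet.
Variables (R : realType) (G : multigraph) (C : {set edge G}) (n : nat).
Variables (v : 'I_n.+1 -> vertex G) (ed : 'I_n.+1 -> edge G) (pos : vertex G -> 'I_n.+1).
Hypothesis ch : circle_chart C v ed pos.

(** Edges off [C] drop out since [pos] is constant along them; on [C], summation by parts moves the
    difference from [w] to [circ], where [circ_laplace] applies. *)
Lemma chart_dirichlet (w : vertex G -> R) (y : vertex G) :
  \sum_e (w (src e) - w (tgt e)) *
         (circ R (pos (src e) - pos y) - circ R (pos (tgt e) - pos y)) =
  2 / n.+1%:R * (\sum_i w (v i)) - 2 * w (v (pos y)).
Proof.
rewrite (bigID (mem C)) /= [X in _ + X]big1 ?addr0; last first.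
  by move=> e eC; rewrite (chart_pos_edge ch eC) subrr mulr0.
rewrite (chart_sum ch).
pose a i := circ R (i - pos y) - circ R (i + inZp 1 - pos y).
transitivity (\sum_i (w (v i) - w (v (i + inZp 1))) * a i).
  apply: eq_bigr => i _; rewrite /a.
  case/orP: (chart_joins ch i) => /andP[/eqP -> /eqP ->]; rewrite !(chart_pos_v ch) //.
  by ring.
rewrite (eq_bigr (fun i => w (v i) * a i - w (v (i + inZp 1)) * a i)); last first.
  by move=> i _; rewrite mulrBl.
rewrite sumrB [X in _ - X](reindex (fun i => i - inZp 1)); last first.
  by exists (fun i => i + inZp 1) => i _; rewrite ?addrK ?subrK.
rewrite -sumrB mulr_sumr -(sum_delta (fun i => w (v i)) (pos y)) mulr_sumr -sumrB.
apply: eq_bigr => i _; rewrite subrK -mulrBr.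
have -> : a i - a (i - inZp 1) = 2 / n.+1%:R - 2 * (i == pos y)%:R.
  rewrite -subr_eq0 -(circ_laplace R) /a subrK.
  by rewrite (addrAC i (- inZp 1)) (addrAC i (inZp 1)); ring.
by ring.
Qed.

End ChartDirichlet.

(** * Resistances of elementary graphs *)

Section Blocks.
Variables (R : realType) (X : special_fibre).
Hypothesis connX : connected_graph X.
Hypothesis elemX : elementary X.
Local Notation RX := (reduction_graph R X).
Implicit Types (x y z : vertex X) (e f : edge X) (C : {set edge X}).

Definition kernel_of_circle C (rho : vertex X -> vertex X -> R) : Prop :=
  exists n (v : 'I_n.+1 -> vertex X) (ed : 'I_n.+1 -> edge X) pos,
    circle_chart C v ed pos /\ forall x y, rho x y = circ R (pos x - pos y).

Lemma circle_kernels : exists rho, forall C, circle C -> kernel_of_circle C (rho C).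
Proof.
have [|rho rhoP] := @choice _ _ (fun C rho => circle C -> kernel_of_circle C rho).
  move=> C; have [cC|cC] := pselect (circle C); last by exists (fun _ _ => 0).
  have [n [v [ed [pos ch]]]] := circle_chart_exists connX elemX cC.
  by exists (fun x y => circ R (pos x - pos y)) => _; exists n, v, ed, pos.
by exists rho.
Qed.

Variable rho : {set edge X} -> vertex X -> vertex X -> R.
Hypothesis rhoP : forall C, circle C -> kernel_of_circle C (rho C).

Definition src_side e : {set vertex X} := [set x | connect (adj (~: [set e])) (src e) x].

(* A block is a separating edge or a circle; the other indices carry the zero
   kernel. *)
Definition block : finType := (edge X + {set edge X})%type.

Definition in_block (b : block) f : bool :=
  match b with
  | inl e => ~~ nonseparating e && (f == e)
  | inr C => `[< circle C >] && (f \in C)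
  end.

Definition bker (b : block) x y : R :=
  match b with
  | inl e => if nonseparating e then 0 else ((x \in src_side e) != (y \in src_side e))%:R
  | inr C => if `[< circle C >] then rho C x y else 0
  end.

Lemma bker_diag b x : bker b x x = 0.
Proof.
case: b => [e|C] /=; case: ifP => //; first by rewrite eqxx.
by move=> /asboolP /rhoP[n [v [ed [pos [ch ->]]]]]; rewrite subrr circ0.
Qed.

Lemma bker_sym b x y : bker b x y = bker b y x.
Proof.
case: b => [e|C] /=; case: ifP => //; first by rewrite eq_sym.
move=> /asboolP /rhoP[n [v [ed [pos [ch rE]]]]].
by rewrite !rE -circN opprB.
Qed.

Lemma src_side_edge e f : f != e -> (src f \in src_side e) = (tgt f \in src_side e).
Proof.
move=> fe; rewrite !inE !(adjC _ (src e)); apply: same_connect; first exact: adjC.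
by apply/connect1/adj_edge; rewrite !inE.
Qed.

Lemma bker_out b f x : ~~ in_block b f -> bker b (src f) x = bker b (tgt f) x.
Proof.
case: b => [e|C] /=; case: ifP => //=.
  by move=> _ fe; rewrite src_side_edge.
move=> /[dup] cC /asboolP /rhoP[n [v [ed [pos [ch rE]]]]] fC.
by rewrite !rE (chart_pos_edge ch).
Qed.

Lemma in_block_exists f : exists b, in_block b f.
Proof.
have [/nonsep_circle[C cC fC]|sf] := boolP (nonseparating f).
  by exists (inr C); rewrite /= fC andbT; apply/asboolP.
by exists (inl f); rewrite /= sf eqxx.
Qed.

(** An edge of a circle does not separate, and elementarity forbids two circles through one edge. *)
Lemma in_block_inj b b' f : in_block b f -> in_block b' f -> b = b'.
Proof.
case: b => [e|C]; case: b' => [e'|C'] /=.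
- by move=> /andP[_ /eqP <-] /andP[_ /eqP <-].
- move=> /andP[se /eqP fe] /andP[/asboolP cC fC].
  by move: se; rewrite -fe /nonseparating (circle_nonsep cC fC).
- move=> /andP[/asboolP cC fC] /andP[se /eqP fe].
  by move: se; rewrite -fe /nonseparating (circle_nonsep cC fC).
move=> /andP[/asboolP cC fC] /andP[/asboolP cC' fC'].
by rewrite (elemX cC cC' fC fC').
Qed.

(** The Dirichlet form for unit edges. With [w] the indicator of [z] it is the Laplacian of [h] at
    [z]; a general [w] also gives fluxes. *)
Definition dform (w h : vertex X -> R) : R :=
  \sum_e (w (src e) - w (tgt e)) * (h (src e) - h (tgt e)).

Lemma dform_sep e w y : ~~ nonseparating e ->
  dform w (fun x => bker (inl e) x y) =
  (w (src e) - w (tgt e)) * (1 - 2 * (y \in src_side e)%:R).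
Proof.
move=> se; rewrite /dform (bigD1 e) //= big1 ?addr0; last first.
  move=> f fe; rewrite (negbTE se) src_side_edge // subrr mulr0 //.
rewrite (negbTE se) !inE connect0; have -> : connect (adj (~: [set e])) (src e) (tgt e) = false.
  exact: negbTE.
by case: (connect _ _ _) => /=; ring.
Qed.

(** For a separating edge the flux changes sign as the pole crosses it. For a circle the uniform
    background cancels, and the retraction fixes both ends of [f]. *)
Lemma dform_block b f w : in_block b f ->
  dform w (fun x => bker b x (src f)) - dform w (fun x => bker b x (tgt f)) =
  2 * w (tgt f) - 2 * w (src f).
Proof.
case: b => [e|C].
  case/andP => se /eqP ->; rewrite !(dform_sep _ _ se) !inE connect0.
  have -> : connect (adj (~: [set e])) (src e) (tgt e) = false by exact: negbTE.
  by rewrite /=; ring.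
case/andP => /[dup] /= bC /asboolP cC fC; rewrite bC.
have [n [v [ed [pos [ch rE]]]]] := rhoP cC.
have vE x : x \in ends C -> v (pos x) = x by rewrite (chart_mem ch) => /eqP.
have dE y : dform w (fun x => rho C x y) = 2 / n.+1%:R * (\sum_i w (v i)) - 2 * w (v (pos y)).
  by rewrite -(chart_dirichlet ch); apply: eq_bigr => e _; rewrite !rE.
by rewrite !dE !vE ?inE ?imset_f ?orbT //; ring.
Qed.

Definition cres x y : R := \sum_b bker b x y.

Lemma dform_cres w y : dform w (fun x => cres x y) = \sum_b dform w (fun x => bker b x y).
Proof.
rewrite /dform exchange_big /=; apply: eq_bigr => e _.
by rewrite /cres -sumrB mulr_sumr.
Qed.

(** The pole is placed at [z] itself; by [dform_cresE] any other pole gives the same mass. *)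
Definition cmass z : R := dform (fun x => (x == z)%:R) (fun x => cres x z) + 2.

Lemma cres_edge b f : in_block b f -> cres (src f) (tgt f) = bker b (src f) (tgt f).
Proof.
move=> bf; rewrite /cres (bigD1 b) //= big1 ?addr0 // => b' b'b.
rewrite bker_out ?bker_diag //; apply: contra b'b => b'f.
by rewrite (in_block_inj b'f bf).
Qed.

(** By connectedness the pole need only cross one edge [f]. The block of [f] changes as in
    [dform_block]; every other block retracts both ends of [f] to the same point. *)
Lemma dform_cresE w y z : dform w (fun x => cres x y) + 2 * w y =
  dform w (fun x => cres x z) + 2 * w z.
Proof.
apply/esym/eqP.
apply: (@connect_inv _ _ (fun y => dform w (fun x => cres x z) + 2 * w z ==
  dform w (fun x => cres x y) + 2 * w y) _ _ _ _ (connX z y)) => // {y} u u' /eqP ->.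
have E f : dform w (fun x => cres x (src f)) + 2 * w (src f) =
           dform w (fun x => cres x (tgt f)) + 2 * w (tgt f).
  have [b bf] := in_block_exists f.
  rewrite !dform_cres (bigD1 b) //= [in RHS](bigD1 b) //=.
  have := dform_block w bf => /eqP; rewrite subr_eq => /eqP ->.
  rewrite (eq_bigr (fun b' => dform w (fun x => bker b' x (tgt f)))); first by ring.
  move=> b' b'b; apply: eq_bigr => e _; rewrite !(bker_sym b' _ (src f)) !(bker_sym b' _ (tgt f)).
  by rewrite !(bker_out (f := f)) //; apply: contra b'b => b'f; rewrite (in_block_inj b'f bf).
by move=> /existsP[f /andP[_ /orP[]/andP[/eqP <- /eqP <-]]]; rewrite E.
Qed.

Lemma cres_cert : @resistance_cert R RX cres cmass.
Proof.
split=> //.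
- by move=> z; rewrite /cres big1 // => b _; rewrite bker_diag.
- by move=> y z; apply: eq_bigr => b _; rewrite bker_sym.
- by move=> e /=; rewrite oner_eq0.
move=> z y; rewrite /cmass.
have := dform_cresE (fun x => (x == z)%:R) y z; rewrite eqxx mulr1 => <-.
by rewrite (eq_sym z) addrK; apply: eq_bigr => e _; rewrite /= divr1.
Qed.

(* The total charge of [w], read off from the flux through the only block
   across which [w] varies. *)
Lemma flux b w y : (forall f, ~~ in_block b f -> w (src f) = w (tgt f)) ->
  \sum_z w z * cmass z = dform w (fun x => bker b x y) + 2 * w y.
Proof.
move=> wb.
have -> : dform w (fun x => bker b x y) = dform w (fun x => cres x y).
  rewrite dform_cres (bigD1 b) //= [X in _ = _ + X]big1 ?addr0 // => b' b'b.
  rewrite /dform big1 // => e _; have [be|nbe] := boolP (in_block b e); last first.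
    by rewrite wb // subrr mul0r.
  rewrite (bker_out (f := e)) ?subrr ?mulr0 //; apply: contra b'b => b'e.
  by rewrite (in_block_inj b'e be).
have H z : w z * cmass z = w z * (dform (fun x => (x == z)%:R) (fun x => cres x y) + 2 * (y == z)%:R).
  by rewrite (dform_cresE _ y z) eqxx mulr1.
under eq_bigr => z _ do rewrite H mulrDr.
rewrite big_split /=; congr (_ + _).
  under eq_bigr => z _ do rewrite /dform mulr_sumr.
  rewrite exchange_big /=; apply: eq_bigr => e _.
  rewrite -(@sum_vertex_bdry R RX w e) mulr_suml; apply: eq_bigr => z _.
  by rewrite mulrA.
rewrite -[RHS](@sum_delta _ _ (fun z => 2 * w z) y); apply: eq_bigr => z _.
by rewrite eq_sym; ring.
Qed.

Lemma gap_sep e : ~~ nonseparating e -> edge_gap (G := RX) cres e = 0.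
Proof.
move=> se; rewrite /edge_gap (@cres_edge (inl e)) /= ?se ?eqxx // (negbTE se).
rewrite !inE connect0; have -> : connect (adj (~: [set e])) (src e) (tgt e) = false by exact: negbTE.
by rewrite subrr.
Qed.

Lemma gap_circle C e : circle C -> e \in C -> edge_gap (G := RX) cres e = #|C|%:R^-1.
Proof.
move=> cC eC; have bC : `[< circle C >] by apply/asboolP.
rewrite /edge_gap (@cres_edge (inr C)) /= ?bC ?eC //.
have [n [v [ed [pos [ch rE]]]]] := rhoP cC; rewrite rE (chart_card ch).
move: eC; rewrite (chart_edges ch) => /imsetP[i _ ->].
have -> : circ R (pos (src (ed i)) - pos (tgt (ed i))) = circ R (inZp 1 : 'I_n.+1).
  case/orP: (chart_joins ch i) => /andP[/eqP -> /eqP ->]; rewrite !(chart_pos_v ch).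
    by rewrite -circN opprB addrAC subrr add0r.
  by rewrite addrAC subrr add0r.
by rewrite circ1; ring.
Qed.

(** Both sides vanish on a separating edge. Otherwise, with [r] the resistance between the ends,
    deleting [e] leaves [r / (1 - r)], and [1 + r / (1 - r)] is the inverse of the gap. *)
Lemma edge_density_gap (e : edge RX) : edge_density e = edge_gap (G := RX) cres e.
Proof.
rewrite /edge_density -[connect _ _ _]/(nonseparating (X := X) e).
case: ifPn => [ne|/gap_sep -> //].
have [C cC eC] := nonsep_circle ne.
have gE := gap_circle cC eC.
have g0 : edge_gap (G := RX) cres e != 0.
  rewrite gE invr_eq0 pnatr_eq0 -lt0n card_gt0; apply/set0Pn; by exists e.
have r1 : cres (src e) (tgt e) != 1.
  by apply: contra g0 => /eqP r1; rewrite /edge_gap r1 subrr.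
rewrite (vresistance_delete _ cres_cert) //= /edge_gap.
have nz : 1 - cres (src e) (tgt e) != 0 by rewrite subr_eq0 eq_sym.
by field; rewrite nz subrK oner_eq0.
Qed.

End Blocks.

(** * Contributions of the blocks *)

Section BlockMasses.
Variables (R : realType) (X : special_fibre).
Hypothesis connX : connected_graph X.
Hypothesis elemX : elementary X.
Local Notation RX := (reduction_graph R X).
Implicit Types (x y z : vertex X) (e f : edge X) (C : {set edge X}).
Variable rho : {set edge X} -> vertex X -> vertex X -> R.
Hypothesis rhoP : forall C, circle C -> kernel_of_circle C (rho C).

Local Notation g := ((genus X)%:R : R).
Local Notation res := (cres rho).
Local Notation K := (cmass rho).
Local Notation gap := (edge_gap (G := RX) res).
Local Notation M := (vmass (X := X) res).
Local Notation cert := (cres_cert connX elemX rhoP).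

Lemma gap_ge0 e : 0 <= gap e.
Proof.
have [/nonsep_circle[C cC eC]|se] := boolP (nonseparating e).
  by rewrite (gap_circle elemX rhoP cC eC) invr_ge0.
by rewrite (gap_sep elemX rhoP se).
Qed.

Lemma n_comp_component (B : {set edge X}) x0 :
  let W := [set x | connect (adj (~: B)) x0 x] in
  n_comp (adj [set f | (f \notin B) && (src f \in W)]) W = 1%N.
Proof.
move=> W; set F := [set f | _]; rewrite -(n_comp_connect (@adjC X F) x0).
apply: eq_n_comp_r => x; rewrite inE; apply/idP/idP => [x0x|]; last first.
  apply: connect_sub => y z /existsP[f /andP[]]; rewrite inE => /andP[fB _] fyz.
  by apply/connect1/existsP; exists f; rewrite inE fB.
suff : (x \in W) && connect (adj F) x0 x by case/andP.
apply: (@connect_inv _ _ (fun x => (x \in W) && connect (adj F) x0 x) _ _ _ _ x0x).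
  move=> y z /andP[yW cy] yz; have zW : z \in W.
    by rewrite inE in yW; rewrite inE; apply: connect_trans yW (connect1 _).
  rewrite zW; apply: connect_trans cy (connect1 _).
  case/existsP: yz => f /andP[fB fyz]; apply/existsP; exists f; rewrite fyz andbT inE.
  rewrite inE in fB; rewrite fB /=.
  by case/orP: fyz => /andP[/eqP -> _].
by rewrite inE !connect0.
Qed.

(* The excess [c] is the share of [W] in the edges of [B] crossing its boundary. *)
Lemma component_mass (B : {set edge X}) x0 (W : {set vertex X}) (c : R) :
  W = [set x | connect (adj (~: B)) x0 x] ->
  (\sum_(e in B) ((src e \in W)%:R + (tgt e \in W)%:R)) / 2 +
    (\sum_x (x \in W)%:R * K x) / 2 = 1 + c ->
  \sum_(e in B) gap e * (((src e \in W)%:R + (tgt e \in W)%:R) / 2) = c ->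
  \sum_x M x * (x \in W)%:R =
  (subgraph_genus W [set f | (f \notin B) && (src f \in W)])%:R + c.
Proof.
move=> defW; pose w x : R := (x \in W)%:R.
rewrite -!/(w _) => h1 h2; set F := [set f | _].
have closedW f : f \notin B -> (tgt f \in W) = (src f \in W).
  move=> fB; rewrite defW !inE !(adjC _ x0); apply/esym/same_connect; first exact: adjC.
  by apply/connect1/adj_edge; rewrite inE.
have ncomp : n_comp (adj F) W = 1%N by rewrite /F defW; exact: n_comp_component.
have s1 := sum_vmass (X := X) res w.
have s2 : 2 * \sum_x M x * w x = \sum_e (w (src e) + w (tgt e)) - 2 * #|W|%:R +
    2 * (\sum_x (ggenus x)%:R * w x) + \sum_x w x * K x.
  have -> : \sum_e (w (src e) + w (tgt e)) = \sum_x w x * (valence x)%:R.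
    have dl z : w z = \sum_x w x * (z == x)%:R.
      by rewrite -[LHS]sum_delta; apply: eq_bigr => x _; rewrite eq_sym.
    under eq_bigr => e _ do rewrite (dl (src e)) (dl (tgt e)) -big_split.
    rewrite exchange_big /=; apply: eq_bigr => x _.
    by rewrite natr_valence mulr_sumr; apply: eq_bigr => e _; rewrite mulrDr.
  have -> : #|W|%:R = \sum_x w x by rewrite -sum1_card natr_sum big_mkcond; apply: eq_bigr => x _; rewrite /w; case: (x \in W).
  rewrite !mulr_sumr -sumrB -!big_split /=; apply: eq_bigr => x _.
  have := canonicalE cert x => /eqP; rewrite eq_sym subr_eq => /eqP => Mx.
  rewrite mulrA Mx; ring.
have splitB (h : edge X -> R) : \sum_e h e * (w (src e) + w (tgt e)) =
    \sum_(e in B) h e * (w (src e) + w (tgt e)) + 2 * \sum_(e in F) h e.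
  rewrite (bigID (mem B)) /=; congr (_ + _).
  rewrite [in RHS]big_mkcond [in LHS]big_mkcond mulr_sumr /=; apply: eq_bigr => e _.
  rewrite !inE; case: ifP => //= eB; last by rewrite mulr0.
  by rewrite /w closedW //; case: (src e \in W) => /=; ring.
have sF : \sum_e (w (src e) + w (tgt e)) =
    \sum_(e in B) (w (src e) + w (tgt e)) + 2 * #|F|%:R.
  have := splitB (fun=> 1); rewrite sumr_const.
  by under eq_bigr => e _ do rewrite mul1r; under [X in _ = X + _]eq_bigr => e _ do rewrite mul1r.
have sgap : \sum_e gap e * ((w (src e) + w (tgt e)) / 2) = c + \sum_(e in F) gap e.
  have := splitB gap => /(congr1 (fun t => t / 2)); rewrite !(mulrDl, mulr_suml).
  under eq_bigr => e _ do rewrite -mulrA.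
  under [X in _ = X + _]eq_bigr => e _ do rewrite -mulrA.
  by move=> ->; rewrite h2; congr (_ + _); field.
have gF : 0 <= \sum_(e in F) gap e by apply: sumr_ge0 => e _; exact: gap_ge0.
(* The mass of [W] is evaluated once through gaps and once through valences and [K]; comparison
   shows that the gaps in [F] add up to the Betti number. *)
have eqF : #|F|%:R + 1 - #|W|%:R = \sum_(e in F) gap e :> R.
  by move: s2; rewrite s1 sgap sF; lra.
(* [betti1] is a truncated subtraction; this bound, from the nonnegativity of gaps, makes it
   exact. *)
have leW : (#|W| <= #|F| + 1)%N.
  by rewrite -(ler_nat R) natrD -subr_ge0 eqF.
have qW : \sum_x (ggenus x)%:R * w x = \sum_(x in W) (ggenus x)%:R.
  rewrite [in RHS]big_mkcond; apply: eq_bigr => x _.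
  by rewrite /w; case: (x \in W); rewrite ?mulr1 ?mulr0.
rewrite s1 sgap /subgraph_genus /betti1 ncomp natrD natrB // natrD -eqF natr_sum -qW.
by ring.
Qed.

End BlockMasses.

(** * Masses cut off by a separating edge or a circle *)

Section BlockValues.
Variables (R : realType) (X : special_fibre).
Hypothesis connX : connected_graph X.
Hypothesis elemX : elementary X.
Hypothesis genus_gt1 : (1 < genus X)%N.
Local Notation RX := (reduction_graph R X).
Implicit Types (x y z : vertex X) (e f : edge X) (C : {set edge X}).
Variable rho : {set edge X} -> vertex X -> vertex X -> R.
Hypothesis rhoP : forall C, circle C -> kernel_of_circle C (rho C).

Local Notation g := ((genus X)%:R : R).
Local Notation res := (cres rho).
Local Notation K := (cmass rho).
Local Notation gap := (edge_gap (G := RX) res).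
Local Notation M := (vmass (X := X) res).
Local Notation cert := (cres_cert connX elemX rhoP).

Lemma vertex_exists : exists y : vertex X, true.
Proof.
have [y _|noV] := pickP (fun _ : vertex X => true); first by exists y.
have V0 : #|[set: vertex X]| = 0%N by apply: eq_card0 => x; have := noV x.
have E0 : #|[set: edge X]| = 0%N by apply: eq_card0 => e; have := noV (src e).
have n0 : n_comp (adj [set: edge X]) [set: vertex X] = 0%N.
  by apply: eq_card0 => x; have := noV x.
move: genus_gt1; rewrite /genus /subgraph_genus /betti1 V0 E0 n0 big1 //.
by move=> x; have := noV x.
Qed.

Lemma sum_cmass : \sum_x K x = 2.
Proof. by have [y _] := vertex_exists; exact: (sum_cert_mass cert y). Qed.

(** This is [component_mass] with no edge removed, where half the total mass 2 of [K] is the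
    required 1. *)
Lemma sum_vmass_genus : \sum_x M x = g.
Proof.
have [y _] := vertex_exists.
transitivity (\sum_x M x * (x \in [set: vertex X])%:R).
  by apply: eq_bigr => x _; rewrite finset.in_setT mulr1.
rewrite (@component_mass R X connX elemX rho rhoP finset.set0 y _ 0) ?big_set0 //.
- by rewrite addr0 /genus; congr (subgraph_genus _ _)%:R; apply/setP => f; rewrite !inE.
- by apply/setP => x; rewrite !inE finset.setC0 (connX y x).
rewrite mul0r add0r addr0; under eq_bigr => x _ do rewrite finset.in_setT mul1r.
by rewrite sum_cmass divff // pnatr_eq0.
Qed.

Lemma total_mass_eq : \sum_(x : vertex X) (ggenus x)%:R + \sum_(e : edge X) gap e = g.
Proof.
rewrite -sum_vmass_genus; have := sum_vmass (X := X) res (fun=> 1).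
under eq_bigr => x _ do rewrite mulr1.
move=> ->; congr (_ + _); first by apply: eq_bigr => x _; rewrite mulr1.
by apply: eq_bigr => e _; field.
Qed.

Lemma tgt_sideE e : ~~ nonseparating e ->
  [set x | connect (adj (~: [set e])) (tgt e) x] = ~: src_side e.
Proof.
move=> se; apply/setP => x; rewrite !inE; apply/idP/idP => [tx|].
  apply: contra se => sx; apply: connect_trans sx _; by rewrite adjC.
apply: contraNT => ntx.
suff : connect (adj (~: [set e])) (src e) x || connect (adj (~: [set e])) (tgt e) x.
  by rewrite (negbTE ntx) orbF.
apply: (@connect_inv _ _ (fun x => connect (adj (~: [set e])) (src e) x ||
  connect (adj (~: [set e])) (tgt e) x) _ _ _ _ (connX (src e) x)); last by rewrite connect0.
move=> u w uP /existsP[f /andP[_ fuw]]; have [fe|fe] := eqVneq f e.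
  by case/orP: fuw => /andP[/eqP a /eqP b]; rewrite -?a -?b fe connect0 ?orbT.
have uw : adj (~: [set e]) u w by apply/existsP; exists f; rewrite !inE fe.
by case/orP: uP => h; apply/orP; [left|right]; apply: connect_trans h (connect1 uw).
Qed.

Lemma side_genusE e x : side_genus e x =
  subgraph_genus [set y | connect (adj (~: [set e])) x y]
    [set f | (f \notin [set e]) && (src f \in [set y | connect (adj (~: [set e])) x y])].
Proof. by congr subgraph_genus; apply/setP => f; rewrite !inE. Qed.

Lemma src_side_cmass e : ~~ nonseparating e -> \sum_x (x \in src_side e)%:R * K x = 1.
Proof.
move=> se; have tf : (tgt e \in src_side e) = false by rewrite inE; exact: negbTE.
rewrite (flux connX elemX rhoP (b := inl e) (src e)); last first.
  by move=> f; rewrite /= se /= => fe; rewrite src_side_edge.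
by rewrite dform_sep // tf !inE connect0 /=; ring.
Qed.

Lemma src_side_vmass e : ~~ nonseparating e ->
  \sum_x M x * (x \in src_side e)%:R = (side_genus e (src e))%:R.
Proof.
move=> se; have tf : (tgt e \in src_side e) = false by rewrite inE; exact: negbTE.
have sf : src e \in src_side e by rewrite inE connect0.
rewrite (@component_mass R X connX elemX rho rhoP [set e] (src e) _ 0) ?big_set1 //.
- by rewrite addr0 side_genusE.
- by rewrite sf tf src_side_cmass //=; field.
by rewrite (gap_sep elemX rhoP se) mul0r.
Qed.

(** Both side genera are values of the additive mass [M] on complementary sets, since [e] has gap
    0. *)
Lemma side_genus_sum e : ~~ nonseparating e ->
  (side_genus e (src e) + side_genus e (tgt e))%N = genus X.
Proof.
move=> se; have tf : (tgt e \in src_side e) = false by rewrite inE; exact: negbTE.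
have sf : src e \in src_side e by rewrite inE connect0.
have Wc (h : vertex X -> R) : \sum_x h x * (x \in ~: src_side e)%:R =
    \sum_x h x - \sum_x h x * (x \in src_side e)%:R.
  rewrite -sumrB; apply: eq_bigr => x _; rewrite finset.in_setC.
  by case: (x \in _) => /=; ring.
apply/eqP; rewrite -(eqr_nat R) natrD -sum_vmass_genus -src_side_vmass // side_genusE tgt_sideE //.
have := Wc M; rewrite (@component_mass R X connX elemX rho rhoP [set e] (tgt e) (~: src_side e) 0) ?big_set1.
- by rewrite addr0 => ->; apply/eqP; ring.
- by rewrite tgt_sideE.
- under eq_bigr => x _ do rewrite mulrC.
  rewrite Wc sum_cmass; under eq_bigr => x _ do rewrite mulrC.
  by rewrite src_side_cmass // !finset.in_setC sf tf /=; field.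
by rewrite (gap_sep elemX rhoP se) mul0r.
Qed.

Section Chart.
Variables (C : {set edge X}) (n : nat).
Variables (v : 'I_n.+1 -> vertex X) (ed : 'I_n.+1 -> edge X) (pos : vertex X -> 'I_n.+1).
Hypothesis cC : circle C.
Hypothesis ch : circle_chart C v ed pos.
Hypothesis rhoE : forall x y, rho C x y = circ R (pos x - pos y).

Lemma branch_cmass i : \sum_x (pos x == i)%:R * K x = 2 / n.+1%:R.
Proof.
have bC : `[< circle C >] by apply/asboolP.
rewrite (flux connX elemX rhoP (b := inr C) (v i)); last first.
  by move=> f; rewrite /= bC /= => fC; rewrite (chart_pos_edge ch).
have -> : dform (fun x => (pos x == i)%:R) (fun x => bker rho (inr C) x (v i)) =
   2 / n.+1%:R * (\sum_j (pos (v j) == i)%:R) - 2 * (pos (v (pos (v i))) == i)%:R.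
  have := chart_dirichlet ch (fun x => (pos x == i)%:R : R) (v i) => /= <-.
  by apply: eq_bigr => e _; rewrite /= bC !rhoE.
rewrite !(chart_pos_v ch) eqxx (eq_bigr (fun j => 1 * (j == i)%:R)); last first.
  by move=> j _; rewrite (chart_pos_v ch) mul1r.
by rewrite (sum_delta (fun=> 1)); ring.
Qed.

Lemma branch_vmass i :
  \sum_x M x * (pos x == i)%:R = (branch_genus (R := R) C (inl (v i)))%:R + n.+1%:R^-1.
Proof.
rewrite /= (chart_branch_vertices ch) (chart_branch_edges ch).
have iE x : (x \in [set x | pos x == i]) = (pos x == i) by rewrite inE.
under eq_bigr => x _ do rewrite -iE.
(* The branch at [v i] touches [C] along [ed i] and its predecessor; on a loop these are the two
   ends of the same edge. *)
have two : \sum_(e in C) ((src e \in [set x | pos x == i])%:R +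
    (tgt e \in [set x | pos x == i])%:R) = 2 :> R.
  rewrite (chart_sum ch).
  transitivity (\sum_j (1 * (j == i)%:R + 1 * (j == i - inZp 1)%:R) : R).
    apply: eq_bigr => j _; rewrite !iE !mul1r -[j == _ - _]subr_eq0 opprB addrA subr_eq0.
    case/orP: (chart_joins ch j) => /andP[/eqP -> /eqP ->]; rewrite !(chart_pos_v ch) //.
    by rewrite [LHS]addrC.
  by rewrite big_split /= !(sum_delta (fun=> 1)).
rewrite (@component_mass R X connX elemX rho rhoP C (v i) _ n.+1%:R^-1).
- by congr ((subgraph_genus _ _)%:R + _); apply/setP => f; rewrite !inE.
- by apply/setP => x; rewrite !inE (chart_pos ch).
- rewrite two; under eq_bigr => x _ do rewrite iE.
  by rewrite branch_cmass; field.
rewrite (eq_bigr (fun e => n.+1%:R^-1 / 2 * ((src e \in [set x | pos x == i])%:R +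
    (tgt e \in [set x | pos x == i])%:R))).
  by rewrite -mulr_sumr two; field.
by move=> e eC; rewrite (gap_circle elemX rhoP cC eC) (chart_card ch); ring.
Qed.

End Chart.

End BlockValues.

(** * Splitting phi into block contributions *)

Section PhiBlocks.
Variables (R : realType) (X : special_fibre).
Hypothesis connX : connected_graph X.
Hypothesis elemX : elementary X.
Hypothesis genus_gt1 : (1 < genus X)%N.
Local Notation RX := (reduction_graph R X).
Implicit Types (x y z : vertex X) (e f : edge X) (C : {set edge X}).
Variable rho : {set edge X} -> vertex X -> vertex X -> R.
Hypothesis rhoP : forall C, circle C -> kernel_of_circle C (rho C).

Local Notation g := ((genus X)%:R : R).
Local Notation res := (cres rho).
Local Notation K := (cmass rho).
Local Notation gap := (edge_gap (G := RX) res).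
Local Notation M := (vmass (X := X) res).
Local Notation cert := (cres_cert connX elemX rhoP).
Local Notation bgenus C x := ((branch_genus (R := R) C (inl x))%:R : R).

Let g0 : g != 0. Proof. by rewrite pnatr_eq0 -lt0n ltnW. Qed.

Definition block_energy (b : block X) (k : vertex X -> R) : R :=
  \sum_x \sum_y k x * M y * bker rho b x y.

Lemma energy_blocks (k : vertex X -> R) :
  \sum_x k x * potential (X := X) res x = \sum_b block_energy b k.
Proof.
rewrite /block_energy exchange_big /=; apply: eq_bigr => x _.
rewrite exchange_big /potential mulr_sumr /=; apply: eq_bigr => y _.
rewrite /cres !mulr_sumr; apply: eq_bigr => b _.
by rewrite (bker_sym rhoP b y) mulrA.
Qed.

Lemma in_block_sum e : \sum_b (in_block (X := X) b e)%:R = 1 :> R.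
Proof.
have [b be] := in_block_exists e.
rewrite (bigD1 b) //= be big1 ?addr0 // => b' b'b.
suff /negbTE -> : ~~ in_block b' e by [].
by apply: contra b'b => b'e; rewrite (in_block_inj elemX b'e be).
Qed.

(** The share of [b] in the formula [phiE]. *)
Definition block_phi (b : block X) : R :=
  - (\sum_e (in_block b e)%:R) / 4 + block_energy b M / g + block_energy b K / (4 * g) +
  (5 * g - 2) / (2 * g) * (\sum_e (in_block b e)%:R * (gap e ^+ 2 / 6)).

Lemma block_phi0 b : (forall x y, bker rho b x y = 0) -> (forall e, in_block b e = false) ->
  block_phi b = 0.
Proof.
move=> b0 e0.
have E0 k : block_energy b k = 0.
  by rewrite /block_energy big1 // => x _; rewrite big1 // => y _; rewrite b0 mulr0.
rewrite /block_phi !E0 !big1; first by ring.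
  by move=> e _; rewrite e0 mul0r.
by move=> e _; rewrite e0.
Qed.

Lemma phi_blocks : phi R X = \sum_b block_phi b.
Proof.
have [y _] := vertex_exists genus_gt1.
rewrite (@phiE R X res K cert (edge_density_gap connX elemX rhoP)
  (total_mass_eq connX elemX genus_gt1 rhoP) g0 y).
rewrite /mass_energy /cert_energy !energy_blocks /block_phi !big_split /=.
rewrite -!mulr_suml sumrN -mulr_sumr.
have eb (h : edge X -> R) : \sum_b \sum_e (in_block b e)%:R * h e = \sum_e h e.
  rewrite exchange_big; apply: eq_bigr => e _ /=.
  by rewrite -mulr_suml in_block_sum mul1r.
rewrite eb; have -> : \sum_(b : block X) \sum_e (in_block b e)%:R = #|edge X|%:R :> R.
  have := eb (fun=> 1); rewrite sumr_const => <-.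
  by apply: eq_bigr => b _; apply: eq_bigr => e _; rewrite mulr1.
by rewrite /gap_sq -mulr_suml; field.
Qed.

(** For indicators [s], [t] of lying on the source side, the kernel is [s + t - 2 * s * t], so the
    double sum factors. *)
Lemma energy_sep e (k : vertex X -> R) : ~~ nonseparating e ->
  block_energy (inl e) k =
  (\sum_x k x * (x \in src_side e)%:R) * g + (\sum_x k x) * (side_genus e (src e))%:R -
  2 * (\sum_x k x * (x \in src_side e)%:R) * (side_genus e (src e))%:R.
Proof.
move=> se; rewrite -(src_side_vmass connX elemX rhoP se) -(sum_vmass_genus connX elemX genus_gt1 rhoP).
rewrite -mulrA !big_distrlr mulr_sumr -big_split -sumrB /=; apply: eq_bigr => x _.
rewrite mulr_sumr -big_split -sumrB /=; apply: eq_bigr => y _; rewrite (negbTE se).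
by case: (x \in _); case: (y \in _) => /=; ring.
Qed.

(** [K] gives mass 1 to each side, so its energy is [g] and cancels the length term [- 1 / 4]. The
    energy of [M] supplies the value, and the gap is 0. *)
Lemma block_phi_sep e : block_phi (inl e) =
  if nonseparating e then 0
  else 2 * (side_genus e (src e))%:R * (side_genus e (tgt e))%:R / g.
Proof.
case: ifPn => [ne|se].
  by apply: block_phi0 => *; rewrite /= ne.
rewrite /block_phi !energy_sep // (src_side_vmass connX elemX rhoP se) (sum_vmass_genus connX elemX genus_gt1 rhoP).
have -> : \sum_x K x * (x \in src_side e)%:R = 1.
  by rewrite -[RHS](src_side_cmass connX elemX rhoP se); apply: eq_bigr => x _; rewrite mulrC.
rewrite (sum_cmass connX elemX genus_gt1 rhoP) /= se /=.
have -> : \sum_(f : edge X) (f == e)%:R = 1 :> R.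
  by rewrite -[RHS](sum_delta (fun=> 1) e); apply: eq_bigr => f _; rewrite mul1r.
have -> : \sum_(f : edge X) (f == e)%:R * (gap f ^+ 2 / 6) = 0.
  rewrite big1 // => f _; have [->|_] := eqVneq f e; last by rewrite mul0r.
  by rewrite (gap_sep elemX rhoP se); ring.
have -> : (side_genus e (tgt e))%:R = g - (side_genus e (src e))%:R.
  by rewrite -(side_genus_sum connX elemX genus_gt1 rhoP se) natrD addrC addKr.
by field.
Qed.

Definition branch_energy C : R :=
  \sum_(x in ends C) \sum_(y in ends C) bgenus C x * bgenus C y * rho C x y.

Section Chart.
Variables (C : {set edge X}) (n : nat).
Variables (v : 'I_n.+1 -> vertex X) (ed : 'I_n.+1 -> edge X) (pos : vertex X -> 'I_n.+1).
Hypothesis cC : circle C.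
Hypothesis ch : circle_chart C v ed pos.
Hypothesis rhoE : forall x y, rho C x y = circ R (pos x - pos y).

Lemma push_sum (k : vertex X -> R) (h : 'I_n.+1 -> R) :
  \sum_x k x * h (pos x) = \sum_i (\sum_x k x * (pos x == i)%:R) * h i.
Proof.
under [RHS]eq_bigr => i _ do rewrite mulr_suml.
rewrite exchange_big /=; apply: eq_bigr => x _.
rewrite -(sum_delta h (pos x)) mulr_sumr; apply: eq_bigr => i _.
by rewrite eq_sym; ring.
Qed.

Lemma energy_circle (k : vertex X -> R) : block_energy (inr C) k =
  \sum_i \sum_j (\sum_x k x * (pos x == i)%:R) * (\sum_y M y * (pos y == j)%:R) * circ R (i - j).
Proof.
have bC : `[< circle C >] by apply/asboolP.
rewrite /block_energy /= bC.
transitivity (\sum_x k x * \sum_y M y * circ R (pos x - pos y)).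
  by apply: eq_bigr => x _; rewrite mulr_sumr; apply: eq_bigr => y _; rewrite rhoE mulrA.
rewrite (push_sum k (fun i => \sum_y M y * circ R (i - pos y))); apply: eq_bigr => i _.
rewrite (push_sum M (fun j => circ R (i - j))) mulr_sumr; apply: eq_bigr => j _.
by rewrite mulrA.
Qed.

Lemma sum_ends (h : vertex X -> R) : \sum_(x in ends C) h x = \sum_i h (v i).
Proof.
rewrite (chart_ends (chart_joins ch) (chart_edges ch)) big_imset /=.
  by apply: eq_bigl => i; rewrite inE.
by move=> i j _ _ /(chart_v_inj ch).
Qed.

Lemma block_phi_chart : block_phi (inr C) =
  (g - 1) / (6 * g) * #|C|%:R + branch_energy C / g.
Proof.
have bC : `[< circle C >] by apply/asboolP.
have n0 : n.+1%:R != 0 :> R by rewrite pnatr_eq0.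
pose a i := bgenus C (v i).
(* The pushed masses [a i + 1 / n.+1] add up to [g]. *)
have sa : \sum_i a i = g - 1.
  have := push_sum M (fun=> 1).
  under eq_bigr => x _ do rewrite mulr1.
  rewrite (sum_vmass_genus connX elemX genus_gt1 rhoP) => ->.
  under [in RHS]eq_bigr => i _ do rewrite mulr1 (branch_vmass connX elemX rhoP cC ch rhoE).
  by rewrite big_split /= sumr_const card_ord -[_^-1 *+ _]mulr_natl divff // addrK.
(* [K] becomes uniform on the circle, so only the constant sums of [circ] over a cycle enter. *)
have EK : block_energy (inr C) K = 2 / n.+1%:R * g * ((n.+1%:R ^+ 2 - 1) / 6).
  rewrite energy_circle exchange_big /=.
  have -> : g = \sum_j (\sum_y M y * (pos y == j)%:R).
    rewrite -(sum_vmass_genus connX elemX genus_gt1 rhoP).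
    transitivity (\sum_x M x * 1); first by apply: eq_bigr => x _; rewrite mulr1.
    by rewrite (push_sum M (fun=> 1)); apply: eq_bigr => j _; rewrite mulr1.
  rewrite mulr_sumr mulr_suml; apply: eq_bigr => j _.
  rewrite -(circ_sum_shift R j) mulr_sumr; apply: eq_bigr => i _.
  rewrite -(branch_cmass connX elemX rhoP cC ch rhoE i); congr (_ * _ * _).
  by apply: eq_bigr => x _; rewrite mulrC.
have EM : block_energy (inr C) M = branch_energy C +
    (2 * (g - 1) + 1) / n.+1%:R * ((n.+1%:R ^+ 2 - 1) / 6).
  have -> : branch_energy C = \sum_i \sum_j a i * a j * circ R (i - j).
    rewrite /branch_energy sum_ends; apply: eq_bigr => i _; rewrite sum_ends.
    by apply: eq_bigr => j _; rewrite rhoE !(chart_pos_v ch).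
  rewrite energy_circle.
  transitivity (\sum_i \sum_j (a i + n.+1%:R^-1) * (a j + n.+1%:R^-1) * circ R (i - j)).
    apply: eq_bigr => i _; apply: eq_bigr => j _.
    by rewrite !(branch_vmass connX elemX rhoP cC ch rhoE).
  transitivity (\sum_i \sum_j a i * a j * circ R (i - j) +
    n.+1%:R^-1 * (\sum_i a i * \sum_j circ R (i - j)) +
    n.+1%:R^-1 * (\sum_j a j * \sum_i circ R (i - j)) +
    n.+1%:R^-1 ^+ 2 * (\sum_(i < n.+1) \sum_j circ R (i - j))).
    have -> : \sum_j a j * (\sum_i circ R (i - j)) = \sum_i \sum_j a j * circ R (i - j).
      by rewrite exchange_big; apply: eq_bigr => j _; rewrite mulr_sumr.
    rewrite !mulr_sumr -!big_split /=; apply: eq_bigr => i _.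
    rewrite !mulr_sumr -!big_split /=; apply: eq_bigr => j _.
    by ring.
  rewrite (eq_bigr _ (fun i _ => congr1 ( *%R (a i)) (circ_sum_shiftr R i))).
  rewrite (eq_bigr _ (fun i _ => congr1 ( *%R (a i)) (circ_sum_shift R i))).
  rewrite [\sum_(i < n.+1) \sum_j circ R (i - j)](eq_bigr _ (fun i _ => circ_sum_shiftr R i)).
  by rewrite -mulr_suml sumr_const card_ord -[(_ / 6) *+ _]mulr_natl sa; field.
have En : \sum_e (in_block (X := X) (inr C) e)%:R = n.+1%:R :> R.
  rewrite /= bC /= -(chart_card ch) -sum1_card natr_sum [RHS]big_mkcond /=.
  by apply: eq_bigr => e _; case: (e \in C).
have Eg : \sum_e (in_block (X := X) (inr C) e)%:R * (gap e ^+ 2 / 6) = (6 * n.+1%:R)^-1.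
  transitivity (\sum_e (in_block (X := X) (inr C) e)%:R * (n.+1%:R ^- 2 / 6) : R).
    apply: eq_bigr => e _; rewrite /= bC /=; have [eC|_] := boolP (e \in C); last by rewrite !mul0r.
    by rewrite (gap_circle elemX rhoP cC eC) (chart_card ch) exprVn.
  by rewrite -mulr_suml En; field.
(* The terms in the inverse of the length cancel between both energies and the squared gaps. *)
rewrite /block_phi EK EM En Eg (chart_card ch).
by move: n0; move: (n.+1%:R : R) => l l0; field; rewrite g0 l0.
Qed.

Lemma branch_energy_ge0_chart : 0 <= branch_energy C.
Proof.
apply: sumr_ge0 => x _; apply: sumr_ge0 => y _.
by rewrite rhoE; apply: mulr_ge0; [rewrite mulr_ge0|exact: circ_ge0].
Qed.

(** All terms are nonnegative and [circ] vanishes only at 0, so a zero sum leaves no two distinct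
    vertices of positive branch genus. *)
Lemma branch_energy_eq0_chart : branch_energy C = 0 <->
  {in ends C &, forall x y, (0 < branch_genus (R := R) C (inl x))%N ->
                            (0 < branch_genus (R := R) C (inl y))%N -> x = y}.
Proof.
have term_ge0 x y : 0 <= bgenus C x * bgenus C y * rho C x y.
  by rewrite rhoE; apply: mulr_ge0; [rewrite mulr_ge0|exact: circ_ge0].
split=> [/eqP h x y xC yC gx gy|h]; last first.
  rewrite /branch_energy big1 // => x xC; rewrite big1 // => y yC.
  have [->|gx] := posnP (branch_genus (R := R) C (inl x)); first by rewrite !mul0r.
  have [->|gy] := posnP (branch_genus (R := R) C (inl y)); first by rewrite mulr0 mul0r.
  by rewrite (h x y xC yC gx gy) rhoE subrr circ0 mulr0.
rewrite psumr_eq0 in h; last by move=> *; apply: sumr_ge0.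
have := allP h x (mem_index_enum x); rewrite xC /= psumr_eq0; last by move=> z _; exact: term_ge0.
move=> /allP/(_ y (mem_index_enum y)); rewrite yC /=.
have [/eqP|/(circ_gt0 R) pxy] := eqVneq (pos x - pos y) 0; last first.
  by rewrite rhoE gt_eqF // mulr_gt0 // mulr_gt0 // ltr0n.
rewrite subr_eq0 => /eqP pxy _.
move: xC yC; rewrite !(chart_mem ch) => /eqP <- /eqP <-.
by rewrite pxy.
Qed.

End Chart.

Lemma block_phi_circle C : block_phi (inr C) =
  if `[< circle C >] then (g - 1) / (6 * g) * #|C|%:R + branch_energy C / g else 0.
Proof.
case: ifPn => [/asboolP cC|nC].
  by have [n [v [ed [pos [ch rhoE]]]]] := rhoP cC; exact: block_phi_chart cC ch rhoE.
by apply: block_phi0 => *; rewrite /= (negbTE nC).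
Qed.

Lemma branch_energy_ge0 C : circle C -> 0 <= branch_energy C.
Proof.
by move=> cC; have [n [v [ed [pos [ch rhoE]]]]] := rhoP cC; exact: branch_energy_ge0_chart rhoE.
Qed.

Lemma branch_energy_eq0 C : circle C -> branch_energy C = 0 <->
  {in ends C &, forall x y, (0 < branch_genus (R := R) C (inl x))%N ->
                            (0 < branch_genus (R := R) C (inl y))%N -> x = y}.
Proof.
by move=> cC; have [n [v [ed [pos [ch rhoE]]]]] := rhoP cC; exact: branch_energy_eq0_chart ch rhoE.
Qed.

End PhiBlocks.

(** * Types of separating edges and the final comparison *)

Lemma sum_delta_types (R : realType) (g m m' : nat) : (m + m')%N = g ->
  \sum_(1 <= i < (g./2).+1) 2 * i%:R * (g%:R - i%:R) / g%:R *
    (((m == i) && (m' == (g - i)%N)) || ((m == (g - i)%N) && (m' == i)))%:R =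
  2 * m%:R * m'%:R / g%:R :> R.
Proof.
move=> mg; have gE : g%:R = m%:R + m'%:R :> R by rewrite -mg natrD.
(* In the range of [i] the edge has a single type, the smaller side genus. If that is 0 it lies
   outside the range and the right-hand side vanishes too. *)
transitivity (\sum_(1 <= i < (g./2).+1 | i == minn m m')
   (2 * i%:R * (g%:R - i%:R) / g%:R) : R).
  rewrite [RHS]big_mkcond [LHS]big_nat [RHS]big_nat /=; apply: eq_bigr => i /andP[i1 i2].
  have -> : ((m == i) && (m' == (g - i)%N)) || ((m == (g - i)%N) && (m' == i)) =
      (i == minn m m') by lia.
  by case: ifP; rewrite ?mulr1 ?mulr0.
rewrite big_nat1_eq; case: ifPn => [_|mm].
  have [_|_] := leqP m m'; rewrite gE; ring.
have [->|->] : m = 0%N \/ m' = 0%N by lia.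
  by rewrite mulr0 !mul0r.
by rewrite mulr0 mul0r.
Qed.

Theorem theorem1p4p3 (R : realType) (X : special_fibre)
    (semistableX : minimal_semistable X)
    (genusX : (1 < genus X)%N)
    (elementaryX : elementary X) :
  let g := genus X in
  let bound : R :=
    (g%:R - 1) / (6 * g%:R) * (delta0 X)%:R +
    \sum_(1 <= i < (g./2).+1)
       2 * i%:R * (g%:R - i%:R) / g%:R * (delta X i)%:R in
  phi R X >= bound /\
  (phi R X = bound <->
   forall C : {set edge X}, circle C ->
   forall A B : gpoint (reduction_graph R X),
     on_circle C A -> on_circle C B ->
     (0 < branch_genus C A)%N -> (0 < branch_genus C B)%N -> A = B).
Proof.
move=> g bound.
have connX := semistableX.1.
have [rho rhoP] := circle_kernels R connX elementaryX.
have g_gt0 : 0 < g%:R :> R by rewrite ltr0n ltnW.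
pose defect := \sum_(C : {set edge X} | `[< circle C >]) branch_energy rho C.
have phi_bound : phi R X = bound + defect / g%:R.
  rewrite (phi_blocks connX elementaryX genusX rhoP) big_sumType /=.
  rewrite (eq_bigr _ (fun e _ => block_phi_sep connX elementaryX genusX rhoP e)).
  rewrite (eq_bigr _ (fun C _ => block_phi_circle connX elementaryX genusX rhoP C)).
  rewrite -[X in _ + X]big_mkcond big_split /= -mulr_suml -mulr_sumr -/defect addrA.
  congr (_ + _); rewrite addrC /bound; congr (_ * _ + _).
    rewrite /delta0 natr_cards.
    under eq_bigr => C _ do rewrite -sum1_card natr_sum.
    (* The circle lengths are counted edge by edge: by [in_block_sum] a nonseparating edge lies on
       exactly one circle and a separating edge on none. *)
    rewrite (exchange_big_dep predT) //=; apply: eq_bigr => e _.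
    have := in_block_sum R elementaryX e; rewrite big_sumType /=.
    have -> : \sum_(f : edge X) (~~ nonseparating f && (e == f))%:R = (~~ nonseparating e)%:R :> R.
      rewrite -[RHS](sum_delta (fun f => (~~ nonseparating f)%:R : R) e).
      by apply: eq_bigr => f _; rewrite eq_sym; case: nonseparating; case: eqP => _ /=; ring.
    move=> /eqP; rewrite addrC eq_sym -subr_eq => /eqP one.
    rewrite big_mkcond /= (eq_bigr (fun C => (`[< circle C >] && (e \in C))%:R)).
      by rewrite -one; case: nonseparating => /=; ring.
    by move=> C _; case: (_ && _).
  rewrite /delta; under [RHS]eq_bigr => i _ do rewrite natr_cards mulr_sumr.
  rewrite exchange_big /=; apply: eq_bigr => e _; rewrite /separating_of_type.
  case: ifPn => [ne|se] /=.
    by rewrite big1 // => i _; rewrite mulr0.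
  have sg := side_genus_sum connX elementaryX genusX rhoP se.
  by rewrite -(sum_delta_types R sg).
have energy_ge0 C : `[< circle C >] -> 0 <= branch_energy rho C.
  by move=> /asboolP; exact: branch_energy_ge0.
have defect_ge0 : 0 <= defect by exact: sumr_ge0.
split; first by rewrite phi_bound lerDl divr_ge0 // ltW.
have -> : (phi R X = bound) <-> (defect == 0).
  rewrite phi_bound; split=> [/eqP|/eqP ->]; last by rewrite mul0r addr0.
  by rewrite -subr_eq0 addrAC subrr add0r mulf_eq0 invr_eq0 (gt_eqF g_gt0) orbF.
rewrite psumr_eq0 //; split.
  move=> /allP h C cC; have /eqP := implyP (h C (mem_index_enum C)) (asboolT cC).
  (* Interior points of edges have branch genus 0, so only pairs of vertices remain. *)
  move=> /(branch_energy_eq0 rhoP cC) inj [x|[e t]] [y|[f u]] //= xC yC gx gy.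
  by rewrite (inj x y).
move=> h; apply/allP => C _; apply/implyP => /asboolP cC; apply/eqP.
apply/(branch_energy_eq0 rhoP cC) => x y xC yC gx gy.
by have [] := h C cC (inl x) (inl y) xC yC gx gy.
Qed.
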